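(* Let $A$ be a real isotropic $d\times d$ dilation matrix and let $m\ge 1$ be an integer. With the positive definite quadratic form $P$, the trigonometric polynomial $G$, the trigonometric polynomial mask $m_0$ and the function $M$ associated with $A$ as in the context, one has $$\prod_{j=1}^{\infty}\Bigl(m_0\bigl((A^{-T})^{j}\xi\bigr)\Bigr)^m=\frac{(G(\xi))^m}{(P(\xi))^m}\,(M(\xi))^m,\qquad \xi\in\mathbb{R}^d$$ (with $G/P$ interpreted as $1$ at $\xi=0$). That is, the scaling function with mask $m_0^m$ has Fourier transform $\dfrac{G^m}{P^m}M^m$. Moreover, the function $M^m$ is continuous on $\mathbb{R}^d$ and does not decay at infinity (it does not tend to $0$ as $|\xi|\to\infty$).
   Context: A real isotropic dilation matrix is a $d\times d$ matrix $A$ with integer entries, all of whose eigenvalues are greater than $1$ in absolute value, which is diagonalizable over $\mathbb{C}$ and all of whose eigenvalues have equal absolute value. Put $q:=|\det A|$ and $A^{-T}:=(A^T)^{-1}$. One can factor $A^{-T}=q^{-1/d}Q^{-1}UQ$ with $U$ real orthogonal and $Q$ real symmetric positive definite; fix such a $Q$ and write $Q^2=(q_{ij})_{1\le i,j\le d}$. Define $$P(\xi):=\xi^TQ^2\xi=\sum_{i} q_{ii}\xi_i^2+2\sum_{i<j}q_{ij}\xi_i\xi_j,\qquad G(\xi):=4\sum_{i} q_{ii}\sin^2\frac{\xi_i}{2}+2\sum_{i<j}q_{ij}\sin\xi_i\sin\xi_j .$$ Let $S(A^T):=\{s\in[0,1)^d: A^Ts\in\mathbb{Z}^d\}$ (this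 set has $q$ elements and contains $0$), and define the mask $$m_0(\xi):=\prod_{s\in S(A^T)\setminus\{0\}}\frac{G(\xi+2\pi s)}{G(2\pi s)}.$$ Define $$\mu(\xi):=\frac{q^{2/d}\,m_0(A^{-T}\xi)\,G(A^{-T}\xi)}{G(\xi)},$$ where at the points of $2\pi\mathbb{Z}^d$ (zeros of $G$) the value is understood as the limit, and $$M(\xi):=\prod_{j=0}^\infty\mu\bigl((A^{-T})^j\xi\bigr).$$ The scaling function with mask $\tilde m$ is the tempered distribution whose Fourier transform is $\prod_{j\ge1}\tilde m((A^{-T})^j\xi)$; the Fourier transform is $\hat f(\xi)=\int_{\mathbb{R}^d} f(x)e^{-i\xi\cdot x}\,dx$. *)

(* Defs.v *)
From HB Require Import structures.
From mathcomp Require Import all_boot all_order all_algebra.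
From mathcomp Require Import all_classical all_reals all_analysis.
From mathcomp Require Import complex.

Set Implicit Arguments.
Unset Strict Implicit.
Unset Printing Implicit Defensive.

Import Order.TTheory GRing.Theory Num.Theory.
Import numFieldNormedType.Exports.

Local Open Scope classical_set_scope.
Local Open Scope ring_scope.

(* Points of R^d are column vectors 'cV[R]_d; the complex field is R[i]. *)

Definition isotropic_dilation (R : realType) (d : nat) (A : 'M[int]_d) : Prop :=
  let AC : 'M[R[i]]_d := map_mx intr A in
  [/\ forall z : R[i], eigenvalue AC z -> 1 < `|z|,
      diagonalizable AC
    & forall z w : R[i], eigenvalue AC z -> eigenvalue AC w -> `|z| = `|w|].

Definition posdefmx (R : realType) (d : nat) (Q : 'M[R]_d) : Prop :=
  Q^T = Q /\ forall x : 'cV[R]_d, x != 0 -> 0 < (x^T *m Q *m x) ord0 ord0.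

Definition orthogonalmx (R : realType) (d : nat) (U : 'M[R]_d) : Prop :=
  U *m U^T = 1%:M.

Definition qdet (d : nat) (A : 'M[int]_d) : nat := `|\det A|%N.

Definition invtr (R : realType) (d : nat) (A : 'M[int]_d) : 'M[R]_d :=
  invmx (map_mx intr A : 'M[R]_d)^T.

Definition isotropic_factor (R : realType) (d : nat) (A : 'M[int]_d)
    (Q : 'M[R]_d) : Prop :=
  posdefmx Q /\
  exists2 U : 'M[R]_d, orthogonalmx U &
    invtr R A =
      ((qdet A)%:R `^ (- d%:R^-1)) *: (invmx Q *m U *m Q).

Definition Pform (R : realType) (d : nat) (Q : 'M[R]_d) (xi : 'cV[R]_d) : R :=
  (xi^T *m (Q *m Q) *m xi) ord0 ord0.

Definition Gpoly (R : realType) (d : nat) (Q : 'M[R]_d) (xi : 'cV[R]_d) : R :=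
  4 * (\sum_(i < d) (Q *m Q) i i * sin (xi i ord0 / 2) ^+ 2) +
  2 * (\sum_(i < d) \sum_(j < d | (i < j)%N)
         (Q *m Q) i j * sin (xi i ord0) * sin (xi j ord0)).

Definition digits (R : realType) (d : nat) (A : 'M[int]_d) : set 'cV[R]_d :=
  [set s : 'cV[R]_d | (forall i, 0 <= s i ord0 < 1) /\
           exists k : 'cV[int]_d,
             (map_mx intr A : 'M[R]_d)^T *m s = map_mx intr k].

Arguments digits R {d} A _.

(* A finitely supported product, meaningful because [digits R A] is finite: it
   has [qdet A] elements. *)
Definition dilation_mask (R : realType) (d : nat) (A : 'M[int]_d) (Q : 'M[R]_d)
    (xi : 'cV[R]_d) : R :=
  \big[*%R/1]_(s \in digits R A `\ (0 : 'cV[R]_d))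
    (Gpoly Q (xi + (2 * pi) *: s) / Gpoly Q ((2 * pi) *: s)).

Definition lattice2pi (R : realType) (d : nat) : set 'cV[R]_d :=
  [set xi : 'cV[R]_d | exists k : 'cV[int]_d, xi = (2 * pi) *: map_mx intr k].

Definition mu_quot (R : realType) (d : nat) (A : 'M[int]_d) (Q : 'M[R]_d)
    (xi : 'cV[R]_d) : R :=
  (qdet A)%:R `^ (2 / d%:R) * dilation_mask A Q (invtr R A *m xi)
    * Gpoly Q (invtr R A *m xi) / Gpoly Q xi.

Definition mu (R : realType) (d : nat) (A : 'M[int]_d) (Q : 'M[R]_d)
    (xi : 'cV[R]_d) : R :=
  if `[< lattice2pi xi >] then lim (mu_quot A Q eta @[eta --> xi^'])
  else mu_quot A Q xi.

Definition M_partial (R : realType) (d : nat) (A : 'M[int]_d) (Q : 'M[R]_d)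
    (xi : 'cV[R]_d) (n : nat) : R :=
  \prod_(0 <= j < n) mu A Q (invtr R A ^+ j *m xi).

Definition Mfun (R : realType) (d : nat) (A : 'M[int]_d) (Q : 'M[R]_d)
    (xi : 'cV[R]_d) : R :=
  lim (M_partial A Q xi n @[n --> \oo]).

Definition GP_quot (R : realType) (d : nat) (m : nat) (Q : 'M[R]_d)
    (xi : 'cV[R]_d) : R :=
  if xi == 0 then 1 else Gpoly Q xi ^+ m / Pform Q xi ^+ m.

Definition mask_partial (R : realType) (d : nat) (B : 'M[R]_d)
    (mask : 'cV[R]_d -> R) (xi : 'cV[R]_d) (n : nat) : R :=
  \prod_(1 <= j < n.+1) mask (B ^+ j *m xi).

Definition mask_prod (R : realType) (d : nat) (B : 'M[R]_d)
    (mask : 'cV[R]_d -> R) (xi : 'cV[R]_d) : R :=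
  lim (mask_partial B mask xi n @[n --> \oo]).

(* Lebesgue measure on R^d, carried by d.-tuple R with its product
   sigma-algebra: on R^(n+1) it is the image by cons of the product of the
   Lebesgue measures of R and R^n. *)

Section cons_measure.
Context (R : realType) (n : nat)
  (nu : {sigma_finite_measure set (n.-tuple (measurableTypeR R)) -> \bar R}).

Definition tcons (p : measurableTypeR R * n.-tuple (measurableTypeR R)) : n.+1.-tuple (measurableTypeR R) := [tuple of p.1 :: p.2].

Lemma measurable_tcons : measurable_fun [set: measurableTypeR R * n.-tuple (measurableTypeR R)] tcons.
Proof. by apply: measurable_cons; [exact: measurable_fst|exact: measurable_snd]. Qed.

Definition cons_measure : set (n.+1.-tuple (measurableTypeR R)) -> \bar R :=
  pushforward (lebesgue_measure \x nu)%E tcons.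

Let cons_measure0 : cons_measure set0 = 0%E.
Proof. by rewrite /cons_measure /pushforward preimage_set0 measure0. Qed.

Let cons_measure_ge0 A : (0 <= cons_measure A)%E.
Proof. by rewrite /cons_measure /pushforward; exact: measure_ge0. Qed.

Let cons_measure_sigma_additive : semi_sigma_additive cons_measure.
Proof.
move=> F mF tF mUF; rewrite /cons_measure /pushforward preimage_bigcup.
have mt X : measurable X -> measurable (tcons @^-1` X).
  by move=> mX; rewrite -[_ @^-1` _]setTI; exact: measurable_tcons.
apply: measure_semi_sigma_additive.
- by move=> k; exact: mt.
- apply/trivIsetP => /= i j _ _ ij; rewrite -preimage_setI.
  by move/trivIsetP : tF => /(_ _ _ _ _ ij) ->//; rewrite preimage_set0.
- by rewrite -preimage_bigcup; exact: mt.
Qed.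

HB.instance Definition _ := isMeasure.Build _ _ _ cons_measure
  cons_measure0 cons_measure_ge0 cons_measure_sigma_additive.

Let cons_measure_sigma_finite : sigma_finite setT cons_measure.
Proof.
have [F UF mF] : sigma_finite setT (lebesgue_measure \x nu)%E.
  have /sigma_finiteP[F [TF ndF Foo]] := sigma_finiteT (@lebesgue_measure R).
  have /sigma_finiteP[G [TG ndG Goo]] := sigma_finiteT nu.
  exists (fun k => F k `*` G k).
    rewrite -setXTT TF TG predeqE => -[x y]; split.
      move=> [/= [k _ Fkx] [l _ Gly]]; exists (maxn k l) => //; split.
      - by move: x Fkx; exact/subsetPset/ndF/leq_maxl.
      - by move: y Gly; exact/subsetPset/ndG/leq_maxr.
    by move=> [k _ []/= ? ?]; split; exists k.
  move=> k; have [? ?] := Foo k; have [? ?] := Goo k.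
  split; first exact: measurableX.
  by rewrite product_measure1E// lte_mul_pinfty// ge0_fin_numE.
pose split (t : n.+1.-tuple (measurableTypeR R)) : measurableTypeR R * n.-tuple (measurableTypeR R) := (thead t, [tuple of behead t]).
have splitK : cancel tcons split.
  by move=> [a t]; rewrite /split theadE; congr pair; exact/val_inj.
have msplit : measurable_fun setT split.
  apply: measurable_fun_pair; last exact: measurable_behead.
  exact: measurable_tnth.
exists (fun k => split @^-1` F k).
  by rewrite -preimage_bigcup -UF preimage_setT.
move=> k; have [mFk Fk] := mF k; split.
  by rewrite -[_ @^-1` _]setTI; exact: msplit.
rewrite /cons_measure /pushforward.
suff -> : tcons @^-1` (split @^-1` F k) = F k by [].
by apply/seteqP; split=> x /=; rewrite splitK.
Qed.

HB.instance Definition _ := Measure_isSigmaFinite.Build _ _ _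
  cons_measure cons_measure_sigma_finite.

End cons_measure.

Fixpoint lebesgue_tuple (R : realType) (d : nat) :
    {sigma_finite_measure set (d.-tuple (measurableTypeR R)) -> \bar R} :=
  if d is n.+1 then cons_measure (lebesgue_tuple R n)
  else dirac ([tuple] : 0.-tuple (measurableTypeR R)).

Definition vec_of_tuple (R : realType) (d : nat) (t : d.-tuple (measurableTypeR R)) :
    'cV[R]_d :=
  \col_i tnth t i.

Definition cintegrable (R : realType) (d : nat) (f : 'cV[R]_d -> R[i]) : Prop :=
  (lebesgue_tuple R d).-integrable setT
    (fun t => (complex.Re (f (vec_of_tuple t)))%:E) /\
  (lebesgue_tuple R d).-integrable setT
    (fun t => (complex.Im (f (vec_of_tuple t)))%:E).

Definition cintegral (R : realType) (d : nat) (f : 'cV[R]_d -> R[i]) : R[i] :=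
  Complex
    (\int[lebesgue_tuple R d]_(t in setT) complex.Re (f (vec_of_tuple t)))
    (\int[lebesgue_tuple R d]_(t in setT) complex.Im (f (vec_of_tuple t))).

(* The Fourier transform with kernel exp (- i xi . x). *)
Definition fourier (R : realType) (d : nat) (f : 'cV[R]_d -> R[i])
    (xi : 'cV[R]_d) : R[i] :=
  cintegral (fun x =>
    let theta := (xi^T *m x) ord0 ord0 in
    f x * Complex (cos theta) (- sin theta)).

(* Iterated partial derivatives; the list of coordinates along which one
   differentiates plays the role of the multi-index. *)
Fixpoint dpartial (R : realType) (d : nat) (s : seq 'I_d)
    (g : 'cV[R]_d -> R) : 'cV[R]_d -> R :=
  if s is i :: s' then
    fun x => 'D_(delta_mx i ord0 : 'cV[R]_d) (dpartial s' g) x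
  else g.

Definition smooth (R : realType) (d : nat) (g : 'cV[R]_d -> R) : Prop :=
  forall (s : seq 'I_d) (x : 'cV[R]_d), differentiable (dpartial s g) x.

(* [B] bounds the N-th Schwartz seminorm of [f]. *)
Definition seminorm_le (R : realType) (d : nat) (N : nat) (B : R)
    (f : 'cV[R]_d -> R[i]) : Prop :=
  forall (s : seq 'I_d) (x : 'cV[R]_d), (size s <= N)%N ->
    (1 + `|x|) ^+ N * `|dpartial s (fun y => complex.Re (f y)) x| <= B /\
    (1 + `|x|) ^+ N * `|dpartial s (fun y => complex.Im (f y)) x| <= B.

Definition schwartz (R : realType) (d : nat) (f : 'cV[R]_d -> R[i]) : Prop :=
  [/\ smooth (fun x => complex.Re (f x)), smooth (fun x => complex.Im (f x))
    & forall N, exists B, seminorm_le N B f].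

(* Only the values of [phi] on Schwartz functions are meaningful. *)
Definition tempered_distribution (R : realType) (d : nat)
    (phi : ('cV[R]_d -> R[i]) -> R[i]) : Prop :=
  (forall (a : R[i]) (f g : 'cV[R]_d -> R[i]), schwartz f -> schwartz g ->
     phi (fun x => a * f x + g x) = a * phi f + phi g) /\
  exists (N : nat) (c : R), forall (f : 'cV[R]_d -> R[i]) (B : R),
    schwartz f -> seminorm_le N B f -> `|phi f| <= (c * B)%:C%C.

(* [phi^], defined by duality as f |-> phi (f^), is the function [F]. *)
Definition has_fourier_transform (R : realType) (d : nat)
    (phi : ('cV[R]_d -> R[i]) -> R[i]) (F : 'cV[R]_d -> R) : Prop :=
  forall f : 'cV[R]_d -> R[i], schwartz f ->
    cintegrable (fun xi => (F xi)%:C%C * f xi) /\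
    phi (fourier f) = cintegral (fun xi => (F xi)%:C%C * f xi).

(* The tempered distribution whose Fourier transform is the infinite product;
   only real-valued masks are considered. *)
Definition scaling_function (R : realType) (d : nat) (A : 'M[int]_d)
    (mask : 'cV[R]_d -> R) (phi : ('cV[R]_d -> R[i]) -> R[i]) : Prop :=
  tempered_distribution phi /\
  has_fourier_transform phi (mask_prod (invtr R A) mask).

Definition tends_to_0_at_infinity (R : realType) (d : nat)
    (f : 'cV[R]_d -> R) : Prop :=
  forall e : R, 0 < e ->
    exists r : R, forall xi : 'cV[R]_d, r < `|xi| -> `|f xi| < e.

(* Main.v *)
Require Import Defs.
From HB Require Import structures.
From mathcomp Require Import all_boot all_order all_algebra.
From mathcomp Require Import all_classical all_reals all_analysis.
From mathcomp Require Import complex.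
From mathcomp Require Import zify ring lra.

Set Implicit Arguments.
Unset Strict Implicit.
Unset Printing Implicit Defensive.

Import Order.TTheory GRing.Theory Num.Theory.
Import numFieldNormedType.Exports.

Local Open Scope classical_set_scope.
Local Open Scope ring_scope.

(** Throughout, [B] stands for [A^{-T}], [rho] for [q^(-1/d)], [m0] for the mask
    and [H] for the quotient [G/P] extended by [1] at the origin.

    Because [4 sin^2(t/2) = (1 - cos t)^2 + sin^2 t], the polynomial [G] is a
    nonnegative combination of squares plus [P] at the vector of sines
    ([GpolyE]).  Hence [G] vanishes exactly on [2 pi Z^d] ([Gpoly_eq0]) and
    [G = P + O(|x|^4)] at the origin, so that [H] is continuous there.  On the
    other hand [P (B x) = rho^2 P x] since [B] is [rho] times a matrix
    conjugated by [Q] to an orthogonal one, and [rho < 1] because [|det A|] is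
    a product of eigenvalues of modulus greater than one.

    Up to a constant, [m0 G] is the product of the translates [G (x + 2 pi s)]
    over all [s] in [S(A^T)] ([maskMG]).  Translations by [B k], for [k]
    integral, permute [S(A^T)] modulo [Z^d]; so the numerator
    [m0 (B x) G (B x)] of [mu] is [2 pi Z^d]-periodic and has the same zeros as
    the denominator [G x] ([digits_prod_eq0]).  As
    [mu x = m0 (B x) H (B x) / H x] near the origin, [mu] tends to [1] there,
    hence at every lattice point, and [mu] is a continuous, everywhere positive
    function.

    The last formula telescopes: away from the nonzero lattice points
    [\prod_(j < n) mu (B^j x) = (\prod_(1 <= j <= n) m0 (B^j x)) H (B^n x) / H x]
    ([M_partial_telescope]).  The product of the [m0 (B^j x)] converges since
    [|m0 y - 1| <= C |y|] and [B^j x] tends to zero geometrically, which yields both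
    the convergence of [M] and the identity [\prod_j m0 (B^j x) = H x M x].  At
    a nonzero lattice point both sides vanish: the orbit [B^j x] tends to the
    origin, so it leaves the lattice, and [m0] is zero at the first point outside.

    Continuity of [M] at the origin follows from that of the product of the
    masks and of [H]; it propagates through [M x = mu x ... mu (B^(n-1) x) M (B^n x)].
    The same relation shows [M > 0], and, as [mu = 1] on the lattice, that [M]
    is constant along the unbounded sequence [(A^T)^n x] for a nonzero lattice
    point [x]: [M] does not decay. *)

(** * Sine and cosine estimates *)

Section sine_estimates.
Variable R : realType.
Implicit Types x y : R.

Lemma lipschitz_of_deriv (f df : R -> R) (K : R) :
  (forall x, is_derive x 1 f (df x)) -> continuous f ->
  (forall x, `|df x| <= K) -> forall x y, `|f x - f y| <= K * `|x - y|.
Proof.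
move=> fdf cf dfK x y; wlog xy : x y / y <= x.
  move=> H; have [/H//|/ltW/H] := leP y x.
  by rewrite distrC (distrC y).
have [c _ ->] := MVT_segment xy (fun z _ => fdf z) (continuous_subspaceT cf).
by rewrite normrM ler_wpM2r.
Qed.

Lemma norm_sinB_le x y : `|sin x - sin y| <= `|x - y|.
Proof.
rewrite -[leRHS]mul1r; apply: (lipschitz_of_deriv (df := cos)) => //.
- exact: continuous_sin.
- exact: cos_max.
Qed.

Lemma norm_cosB_le x y : `|cos x - cos y| <= `|x - y|.
Proof.
rewrite -[leRHS]mul1r; apply: (lipschitz_of_deriv (df := fun z => - sin z)) => //.
- exact: continuous_cos.
- by move=> z; rewrite normrN sin_max.
Qed.

Lemma norm_sin_le x : `|sin x| <= `|x|.
Proof. by have := norm_sinB_le x 0; rewrite sin0 !subr0. Qed.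

Lemma oneB_cosE x : 1 - cos x = 2 * sin (x / 2) ^+ 2.
Proof.
have -> : cos x = cos ((x / 2) *+ 2) by congr cos; field.
by rewrite cos_mulr2n cos2sin2; ring.
Qed.

Lemma sin_half_sqr x : 4 * sin (x / 2) ^+ 2 = (1 - cos x) ^+ 2 + sin x ^+ 2.
Proof.
have := oneB_cosE x; have := sin2cos2 x; nra.
Qed.

Lemma oneB_cos_le x : 1 - cos x <= x ^+ 2 / 2.
Proof.
rewrite oneB_cosE; have := norm_sin_le (x / 2).
rewrite -(ler_pXn2r (n := 2)) ?nnegrE ?normr_ge0// !real_normK ?num_real//.
nra.
Qed.

(** Integrating [1 - cos t <= t^2/2]. *)
Lemma norm_sinB_id_le x : `|sin x - x| <= `|x| ^+ 3 / 2.
Proof.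
wlog x0 : x / 0 <= x.
  move=> H; have [/H//|/ltW x0] := leP 0 x.
  by have := H (- x); rewrite oppr_ge0 sinN -opprD !normrN; apply.
have dg (z : R) : is_derive z (1 : R) (fun t : R => sin t - t) (cos z - 1).
  by apply: is_deriveB.
have cg : continuous (fun t : R => sin t - t).
  by move=> t; apply: cvgB; [exact: continuous_sin|exact: cvg_id].
have [c] := MVT_segment x0 (fun z _ => dg z) (continuous_subspaceT cg).
rewrite in_itv/= sin0 !subr0 => /andP[c0 cx] ->.
rewrite normrM distrC (ger0_norm x0) ger0_norm ?subr_ge0 ?cos_le1//.
have := oneB_cos_le c; have : c ^+ 2 <= x ^+ 2 by rewrite ler_pXn2r ?nnegrE.
move=> H1 H2; rewrite exprSr mulrAC ler_wpM2r//; lra.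
Qed.

End sine_estimates.

(** * Products of factors geometrically close to one *)

Section infinite_product.
Variable R : realType.
Implicit Types (u : nat -> R) (C r : R).

Lemma geometric_sum_le C r n : 0 <= C -> 0 <= r < 1 ->
  \sum_(0 <= i < n) C * r ^+ i <= C / (1 - r).
Proof.
move=> C0 /andP[r0 r1]; rewrite -mulr_sumr ler_wpM2l// -[leRHS]div1r.
rewrite ler_pdivlMr ?subr_gt0// big_mkord mulrC.
have := subrX1 r n; have := exprn_ge0 n r0; lra.
Qed.

Lemma prod_le_expR u C r n : 0 <= C -> 0 <= r < 1 ->
  (forall j, `|u j - 1| <= C * r ^+ j) ->
  `|\prod_(0 <= j < n) u j| <= expR (C / (1 - r)).
Proof.
move=> C0 r01 uC; apply: (@le_trans _ _ (expR (\sum_(0 <= j < n) C * r ^+ j))).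
  elim: n => [|n IH]; first by rewrite !big_geq// expR0 normr1.
  rewrite !big_nat_recr//= normrM expRD ler_pM//.
  have -> : u n = 1 + (u n - 1) by rewrite addrC subrK.
  rewrite (le_trans (ler_normD _ _))// normr1 (le_trans _ (expR_ge1Dx _))//.
  by rewrite lerD2l.
by rewrite ler_expR geometric_sum_le.
Qed.

(** The partial products [p n] stay bounded, so their increments
    [p n (u n - 1)] are dominated by a geometric series. *)
Lemma cvg_prod_geometric u C r : 0 <= C -> 0 <= r < 1 ->
  (forall j, `|u j - 1| <= C * r ^+ j) ->
  cvg (\prod_(0 <= j < n) u j @[n --> \oo]) /\
  forall n, `|\prod_(0 <= j < n) u j - 1| <=
    expR (C / (1 - r)) * C / (1 - r).
Proof.
move=> C0 r01 uC; pose p n := \prod_(0 <= j < n) u j.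
pose K := expR (C / (1 - r)) * C.
have K0 : 0 <= K by rewrite mulr_ge0 ?expR_ge0.
have dp n : `|telescope p n| <= K * r ^+ n.
  have -> : telescope p n = p n * (u n - 1).
    by rewrite /telescope/= /p big_nat_recr//= mulrBr mulr1.
  by rewrite normrM /K -mulrA ler_pM//; exact: prod_le_expR.
have pE n : p n = 1 + series (telescope p) n.
  by rewrite {1}(eq_sum_telescope p) {1}/p big_geq.
split.
  rewrite (_ : (fun n => _) = cst 1 + series (telescope p)); last first.
    by apply/funext => n; exact: pE.
  apply: is_cvgD; first exact: is_cvg_cst.
  apply: normed_cvg; apply: (series_le_cvg (v_ := geometric K r)) => [n|n|n|] //=.
    by rewrite mulr_ge0// exprn_ge0//; case/andP: r01.
  apply: is_cvg_geometric_series.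
  by case/andP: r01 => r0 r1; rewrite ger0_norm.
move=> n; rewrite -/(p n) pE [1 + _]addrC addrK.
apply: (le_trans (ler_norm_sum _ _ _)); apply: le_trans (geometric_sum_le n K0 r01).
by apply: ler_sum => i _; exact: dp.
Qed.

End infinite_product.

(** * Periods of the trigonometric functions *)

Section trigonometric_periods.
Variable R : realType.
Implicit Types (x : R) (k : int).

Lemma periodic_intr (f : R -> R) (T : R) k x :
  periodic f T -> f (x + T * k%:~R) = f x.
Proof.
move=> fT; have fn (n : nat) y : f (y + T * n%:R) = f y.
  by rewrite mulr_natr periodicn.
case: k => n; first by rewrite -pmulrn fn.
by rewrite NegzE mulrNz mulrN -pmulrn -[in RHS](subrK (T * n.+1%:R) x) fn.
Qed.

Lemma sinD2pi_int k x : sin (x + 2 * pi * k%:~R) = sin x.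
Proof. by apply: periodic_intr; rewrite mulr_natl; exact: sinD2pi. Qed.

Lemma cosD2pi_int k x : cos (x + 2 * pi * k%:~R) = cos x.
Proof. by apply: periodic_intr; rewrite mulr_natl; exact: cosD2pi. Qed.

Lemma cos_eq1 x : cos x = 1 -> exists k : int, x = 2 * pi * k%:~R.
Proof.
move=> cx1; have pi2 : 0 < 2 * pi :> R by rewrite mulr_gt0 ?pi_gt0.
pose k := Num.floor (x / (2 * pi)); exists k.
have /andP[kx xk] := floor_itv (x / (2 * pi)).
have y0 : 0 <= x - 2 * pi * k%:~R.
  by move: kx; rewrite ler_pdivlMr// mulrC subr_ge0.
have y1 : x - 2 * pi * k%:~R < 2 * pi.
  by move: xk; rewrite ltr_pdivrMr// -/k intrD mulrDl mul1r mulrC ltrBlDl.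
have : cos (x - 2 * pi * k%:~R) = 1.
  by rewrite -[RHS]cx1 -[in RHS](subrK (2 * pi * k%:~R) x) cosD2pi_int.
move: y0 y1; set y := x - _ => y0 y1 cy1.
apply/eqP; rewrite -subr_eq0 -/y; move: y0; rewrite le_eqVlt => /predU1P[<-//|y0].
have : 0 < sin (y / 2) by apply: sin_gt0_pi; lra.
by move=> /(exprn_gt0 2); have := oneB_cosE y; rewrite cy1 subrr; lra.
Qed.

End trigonometric_periods.

(** * Column vectors with the max-norm *)

Section sup_norm.
Variable R : realType.

Lemma coord_le_norm d (x : 'cV[R]_d) i : `|x i ord0| <= `|x|.
Proof.
rewrite [leRHS]/Num.norm/= mx_normrE.
exact: (le_bigmax _ (fun ij : 'I_d * 'I_1 => `|x ij.1 ij.2|) (i, ord0)).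
Qed.

Lemma norm_le_coord d (x : 'cV[R]_d) c :
  0 <= c -> (forall i, `|x i ord0| <= c) -> `|x| <= c.
Proof.
move=> c0 xc; rewrite [leLHS]/Num.norm/= mx_normrE.
by apply/bigmax_leP; split => // -[i j] _ /=; rewrite (ord1 j).
Qed.

Lemma mulmx_norm_le d (B : 'M[R]_d) :
  exists2 K : R, 0 < K & forall x : 'cV[R]_d, `|B *m x| <= K * `|x|.
Proof.
exists (1 + \sum_i \sum_j `|B i j|) => [|x].
  by rewrite ltr_pwDl// sumr_ge0// => i _; rewrite sumr_ge0.
apply: norm_le_coord => [|i].
  rewrite mulr_ge0// ltW// ltr_pwDl// sumr_ge0// => i _.
  by rewrite sumr_ge0.
have Bi : \sum_j `|B i j| <= 1 + \sum_i \sum_j `|B i j|.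
  rewrite [X in 1 + X](bigD1 i)//= addrCA lerDl addr_ge0// sumr_ge0// => k _.
  by rewrite sumr_ge0.
rewrite mxE (le_trans (ler_norm_sum _ _ _))// (le_trans _ (ler_wpM2r _ Bi))//.
rewrite mulr_suml ler_sum// => j _.
by rewrite normrM ler_wpM2l// coord_le_norm.
Qed.

Lemma near_normP (V : normedModType R) (x : V) (S : set V) :
  (\forall y \near x, S y) <->
  exists2 r : R, 0 < r & forall y, `|x - y| < r -> S y.
Proof.
split=> [/nbhs_normP[r /= r0 rS]|[r r0 rS]]; first by exists r.
by apply/nbhs_normP; exists r.
Qed.

Lemma near_norm (V : normedModType R) (x : V) (e : R) :
  0 < e -> \forall y \near x, `|x - y| < e.
Proof. by move=> e0; apply/near_normP; exists e. Qed.

(** In a space with a nonzero vector no point is isolated, hence limits along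
    punctured neighbourhoods are unique. *)
Lemma dnbhs_proper (V : normedModType R) (v x : V) :
  v != 0 -> ProperFilter (x^').
Proof.
move=> v0; have nv : 0 < `|v| by rewrite normr_gt0.
apply: Build_ProperFilter_ex => S.
rewrite /dnbhs /within/= => /near_normP[r r0 rS].
have a0 : 0 < r / (2 * `|v|) by rewrite divr_gt0// mulr_gt0.
exists (x + (r / (2 * `|v|)) *: v); apply: rS.
  rewrite opprD addrA subrr sub0r normrN normrZ gtr0_norm//.
  have -> : r / (2 * `|v|) * `|v| = r / 2 by field; rewrite gt_eqF.
  lra.
by rewrite -subr_eq0 addrAC subrr add0r scaler_eq0 (gt_eqF a0) (negPf v0).
Qed.

Lemma continuous_dist_le (V W : normedModType R) (f : V -> W) (x : V) :
  {for x, continuous f} <->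
  forall e : R, 0 < e -> \forall y \near x, `|f x - f y| <= e.
Proof. by split=> [/cvgrPdist_le//|fe]; apply/cvgrPdist_le. Qed.

Lemma cvg_dnbhs_dist_le (V W : normedModType R) (f : V -> W) (x : V) (l : W) :
  f y @[y --> x^'] --> l <->
  forall e : R, 0 < e -> \forall y \near x, y != x -> `|l - f y| <= e.
Proof. by split=> [/cvgrPdist_le//|fe]; apply/cvgrPdist_le. Qed.

Lemma lipschitz_continuous (V W : normedModType R) (f : V -> W) (K : R) :
  0 < K -> (forall x y, `|f x - f y| <= K * `|x - y|) -> continuous f.
Proof.
move=> K0 fK x; apply/continuous_dist_le => e e0.
have : \forall y \near x, `|x - y| < e / K by apply: near_norm; rewrite divr_gt0.
apply: filterS => y xy; rewrite (le_trans (fK _ _))//.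
by rewrite mulrC -ler_pdivlMr// ltW.
Qed.

Lemma mulmx_continuous d (B : 'M[R]_d) : continuous (fun x : 'cV[R]_d => B *m x).
Proof.
have [K K0 BK] := mulmx_norm_le B.
by apply: (lipschitz_continuous K0) => x y; rewrite -mulmxBr.
Qed.

End sup_norm.

(** * The form P and the trigonometric polynomial G *)

Section quadratic_form.
Variables (R : realType) (d : nat) (Q : 'M[R]_d).
Implicit Types x y : 'cV[R]_d.

Lemma PformE x :
  Pform Q x = \sum_i \sum_j (Q *m Q) i j * (x i ord0 * x j ord0).
Proof.
rewrite /Pform mxE exchange_big/=; apply: eq_bigr => j _.
rewrite mxE mulr_suml; apply: eq_bigr => i _; rewrite [x^T _ _]mxE; ring.
Qed.

Hypothesis Qpos : posdefmx Q.

Let Qsym : Q^T = Q := Qpos.1.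

Lemma Pform_sqr x : Pform Q x = \sum_i (Q *m x) i ord0 ^+ 2.
Proof.
rewrite /Pform (_ : _ *m x = (Q *m x)^T *m (Q *m x)); last first.
  by rewrite trmx_mul Qsym !mulmxA.
rewrite mxE.
by apply: eq_bigr => i _; rewrite mxE expr2.
Qed.

Lemma posdef_unitmx : Q \in unitmx.
Proof.
rewrite unitmxE unitfE; apply/det0P => -[v v0 vQ].
have := Qpos.2 v^T; rewrite trmx_eq0 trmxK vQ mul0mx mxE ltxx => /(_ v0).
by [].
Qed.

(** [|x| <= |Q^{-1}| |Q x|], and [|Q x|^2] is at most [P x]. *)
Lemma Pform_ge : exists2 c : R, 0 < c & forall x, c * `|x| ^+ 2 <= Pform Q x.
Proof.
have [K K0 QK] := mulmx_norm_le (invmx Q).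
exists (K ^- 2) => [|x]; first by rewrite invr_gt0 exprn_gt0.
rewrite mulrC ler_pdivrMr ?exprn_gt0// mulrC.
(* P x is the square of the 2-norm of Q x, which dominates the max-norm *)
have Qx : `|Q *m x| ^+ 2 <= Pform Q x.
  have P0 : 0 <= Pform Q x by rewrite Pform_sqr sumr_ge0// => i _; exact: sqr_ge0.
  rewrite -[leRHS]sqr_sqrtr// ler_pXn2r ?nnegrE ?sqrtr_ge0//.
  apply: norm_le_coord => [|i]; first exact: sqrtr_ge0.
  rewrite -sqrtr_sqr ler_sqrt// Pform_sqr (bigD1 i)//= lerDl.
  by rewrite sumr_ge0// => j _; exact: sqr_ge0.
have := QK (Q *m x); rewrite mulKmx ?posdef_unitmx// => xQ.
rewrite (@le_trans _ _ ((K * `|Q *m x|) ^+ 2))//.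
  by rewrite ler_pXn2r ?nnegrE// mulr_ge0// ltW.
by rewrite exprMn ler_wpM2l// exprn_ge0// ltW.
Qed.

Lemma Pform_eq0 x : (Pform Q x == 0) = (x == 0).
Proof.
have [c c0 cP] := Pform_ge; apply/idP/eqP => [/eqP P0|->]; last first.
  by rewrite /Pform mulmx0 mxE.
have := cP x; rewrite P0 pmulr_rle0// => x2; apply/eqP; rewrite -normr_eq0.
by rewrite -[_ == 0](expf_eq0 _ 2) eq_le x2 exprn_ge0.
Qed.

Lemma Pform_ge0 x : 0 <= Pform Q x.
Proof. by rewrite Pform_sqr sumr_ge0// => i _; exact: sqr_ge0. Qed.

Lemma Pform_le : exists2 K : R, 0 < K & forall x, Pform Q x <= K * `|x| ^+ 2.
Proof.
exists (1 + \sum_i \sum_j `|(Q *m Q) i j|) => [|x].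
  by rewrite ltr_pwDl// sumr_ge0// => i _; rewrite sumr_ge0.
rewrite mulrDl mul1r ler_wpDl ?exprn_ge0// PformE mulr_suml ler_sum// => i _.
rewrite mulr_suml ler_sum// => j _; rewrite (le_trans (ler_norm _))//.
by rewrite normrM ler_wpM2l// normrM expr2 ler_pM// coord_le_norm.
Qed.

Lemma sqr_entry_ge0 i : 0 <= (Q *m Q) i i.
Proof.
by rewrite -{1}Qsym mxE sumr_ge0// => j _; rewrite mxE -expr2 sqr_ge0.
Qed.

Lemma sqr_entry_gt0 i : 0 < (Q *m Q) i i.
Proof.
rewrite lt_neqAle sqr_entry_ge0 andbT eq_sym; apply/eqP => q0.
have : Pform Q (delta_mx i ord0) = 0.
  have dE k : (delta_mx i ord0 : 'cV[R]_d) k ord0 = (k == i)%:R.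
    by rewrite mxE eqxx andbT.
  rewrite PformE (bigD1 i)//= (bigD1 i)//= q0 mul0r add0r.
  rewrite big1 ?add0r => [|j /negPf ji]; last by rewrite !dE ji !mulr0.
  rewrite big1// => k /negPf ki; rewrite big1// => j _.
  by rewrite !dE ki mul0r mulr0.
move/eqP; rewrite Pform_eq0 => /eqP/matrixP/(_ i ord0); rewrite !mxE !eqxx.
by move/eqP; rewrite oner_eq0.
Qed.

Lemma Pform_sinE x : Pform Q (map_mx sin x) =
  \sum_i \sum_j (Q *m Q) i j * (sin (x i ord0) * sin (x j ord0)).
Proof.
rewrite PformE; apply: eq_bigr => i _; apply: eq_bigr => j _.
by rewrite ![map_mx _ _ _ _]mxE.
Qed.

(** The identity [sin_half_sqr] exhibits [G] as a sum of nonnegative terms. *)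
Lemma GpolyE x : Gpoly Q x =
  \sum_i (Q *m Q) i i * (1 - cos (x i ord0)) ^+ 2 + Pform Q (map_mx sin x).
Proof.
have symS i j : (Q *m Q) i j = (Q *m Q) j i.
  by rewrite -[in LHS]Qsym -trmx_mul mxE.
pose a i j := (Q *m Q) i j * (sin (x i ord0) * sin (x j ord0)).
have -> : Pform Q (map_mx sin x) = \sum_i a i i +
    2 * \sum_(i < d) \sum_(j < d | (i < j)%N) a i j.
  rewrite Pform_sinE -[LHS]/(\sum_i \sum_j a i j).
  have -> : \sum_i \sum_j a i j = \sum_i (a i i +
      (\sum_(j < d | (i < j)%N) a i j + \sum_(j < d | (j < i)%N) a i j)).
    apply: eq_bigr => i _; rewrite (bigD1 i)//=; congr (_ + _).
    rewrite (bigID (fun j : 'I_d => (i < j)%N))/=; congr (_ + _); apply: eq_bigl => j.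
      by rewrite -(inj_eq val_inj)/=; case: (ltngtP i j).
    by rewrite -(inj_eq val_inj)/=; case: (ltngtP i j).
  rewrite !big_split/= mulr2n mulrDl mul1r; congr (_ + (_ + _)).
  rewrite (exchange_big_dep xpredT)//=; apply: eq_bigr => i _; apply: eq_bigr => j _.
  by rewrite /a symS; congr (_ * _); rewrite mulrC.
rewrite addrA -big_split/= /Gpoly; congr (_ + _ * _).
  rewrite mulr_sumr; apply: eq_bigr => i _; rewrite mulrCA sin_half_sqr mulrDr.
  by rewrite /a -expr2.
by apply: eq_bigr => i _; apply: eq_bigr => j _; rewrite /a mulrA.
Qed.

Lemma Gpoly_ge0 x : 0 <= Gpoly Q x.
Proof.
rewrite GpolyE addr_ge0 ?Pform_ge0// sumr_ge0// => i _.
by rewrite mulr_ge0 ?sqr_entry_ge0 ?sqr_ge0.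
Qed.

(** The first sum of [GpolyE] has positive coefficients, so [G x = 0] forces
    [cos (x i) = 1] for all [i]. *)
Lemma Gpoly_eq0 x : Gpoly Q x = 0 <-> lattice2pi x.
Proof.
split=> [G0|[k ->]]; last first.
  have c1 i : cos (((2 * pi) *: map_mx intr k : 'cV[R]_d) i ord0) = 1.
    by rewrite !mxE -[2 * pi * _]add0r cosD2pi_int cos0.
  have -> : Gpoly Q ((2 * pi) *: map_mx intr k) = Pform Q 0.
    rewrite GpolyE big1 ?add0r => [|i _]; last first.
      by rewrite c1 subrr expr0n mulr0.
    congr Pform; apply/matrixP => i j; rewrite !mxE (ord1 j).
    by rewrite -[2 * pi * _]add0r sinD2pi_int sin0.
  by apply/eqP; rewrite Pform_eq0.
have cx i : cos (x i ord0) = 1.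
  have T0 j : true -> 0 <= (Q *m Q) j j * (1 - cos (x j ord0)) ^+ 2.
    by rewrite mulr_ge0 ?sqr_entry_ge0 ?sqr_ge0.
  move/eqP: G0; rewrite GpolyE paddr_eq0 ?Pform_ge0 ?sumr_ge0//.
  move=> /andP[/eqP sum0 _]; have /eqP := psumr_eq0P T0 sum0 (erefl true : xpredT i).
  by rewrite mulf_eq0 gt_eqF ?sqr_entry_gt0//= sqrf_eq0 subr_eq0 => /eqP <-.
have /choice[k xk] : forall i, exists k : int, x i ord0 = 2 * pi * k%:~R.
  by move=> i; exact: cos_eq1.
exists (\col_i k i); apply/matrixP => i j; rewrite !mxE (ord1 j); exact: xk.
Qed.

Lemma Gpoly_gt0 x : ~ lattice2pi x -> 0 < Gpoly Q x.
Proof.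
by move=> xL; rewrite lt_neqAle Gpoly_ge0 andbT eq_sym; apply/eqP => /Gpoly_eq0.
Qed.

Lemma Gpoly_periodic x (k : 'cV[int]_d) :
  Gpoly Q (x + (2 * pi) *: map_mx intr k) = Gpoly Q x.
Proof.
rewrite !GpolyE; congr (_ + Pform Q _).
  by apply: eq_bigr => i _; rewrite !mxE cosD2pi_int.
by apply/matrixP => i j; rewrite !mxE (ord1 j) sinD2pi_int.
Qed.

(** In [GpolyE], [(1 - cos t)^2] is of order [t^4], and replacing [sin a sin b]
    by [a b] costs a term of total degree four. *)
Lemma GpolyB_Pform_le :
  exists2 K : R, 0 < K & forall x, `|Gpoly Q x - Pform Q x| <= K * `|x| ^+ 4.
Proof.
exists (1 + \sum_i (Q *m Q) i i + \sum_i \sum_j `|(Q *m Q) i j|) => [|x].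
  rewrite -addrA ltr_pwDl// addr_ge0// sumr_ge0// => i _.
    exact: sqr_entry_ge0.
  by rewrite sumr_ge0.
rewrite GpolyE -addrA (le_trans (ler_normD _ _))// !mulrDl lerD//.
  apply: ler_wpDl; first by rewrite mul1r exprn_ge0.
  rewrite mulr_suml (le_trans (ler_norm_sum _ _ _))// ler_sum// => i _.
  rewrite normrM ger0_norm ?sqr_entry_ge0// ler_wpM2l ?sqr_entry_ge0//.
  rewrite ger0_norm ?sqr_ge0// (exprM _ 2 2).
  rewrite ler_pXn2r ?nnegrE ?exprn_ge0 ?subr_ge0 ?cos_le1//.
  rewrite (le_trans (oneB_cos_le _))//.
  have : (x i ord0) ^+ 2 <= `|x| ^+ 2.
    by rewrite -real_normK ?num_real// ler_pXn2r ?nnegrE// coord_le_norm.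
  have := sqr_ge0 (x i ord0); lra.
rewrite Pform_sinE PformE -sumrB (le_trans (ler_norm_sum _ _ _))//.
rewrite mulr_suml ler_sum// => i _.
rewrite -sumrB (le_trans (ler_norm_sum _ _ _))// mulr_suml ler_sum// => j _.
rewrite -mulrBr normrM ler_wpM2l//.
have := norm_sinB_id_le (x i ord0); have := norm_sinB_id_le (x j ord0).
have := norm_sin_le (x j ord0); have := coord_le_norm x i; have := coord_le_norm x j.
move: (x i ord0) (x j ord0) => a b bx ax sb bs as3.
have -> : sin a * sin b - a * b = (sin a - a) * sin b + a * (sin b - b) by ring.
rewrite (le_trans (ler_normD _ _))// !normrM.
have -> : `|x| ^+ 4 = `|x| ^+ 3 / 2 * `|x| + `|x| * (`|x| ^+ 3 / 2) by field.
by rewrite lerD// ler_pM// ?(le_trans as3) ?(le_trans bs) ?(le_trans sb)//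
  ler_wpM2r// ler_pXn2r ?nnegrE.
Qed.

Lemma Gpoly_lipschitz :
  exists2 L : R, 0 < L & forall x y, `|Gpoly Q x - Gpoly Q y| <= L * `|x - y|.
Proof.
exists (1 + \sum_i (Q *m Q) i i * 4 + \sum_i \sum_j `|(Q *m Q) i j| * 2) => [|x y].
  rewrite -addrA ltr_pwDl// addr_ge0// sumr_ge0// => i _.
    by rewrite mulr_ge0// sqr_entry_ge0.
  by rewrite sumr_ge0// => j _; rewrite mulr_ge0.
have xy i : `|x i ord0 - y i ord0| <= `|x - y|.
  by have := coord_le_norm (x - y) i; rewrite !mxE.
have -> : Gpoly Q x - Gpoly Q y =
    \sum_i (Q *m Q) i i * ((1 - cos (x i ord0)) ^+ 2 - (1 - cos (y i ord0)) ^+ 2) +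
    \sum_i \sum_j (Q *m Q) i j *
      (sin (x i ord0) * sin (x j ord0) - sin (y i ord0) * sin (y j ord0)).
  rewrite !GpolyE opprD addrACA -sumrB; congr (_ + _).
    by apply: eq_bigr => i _; rewrite mulrBr.
  rewrite !Pform_sinE -sumrB; apply: eq_bigr => i _; rewrite -sumrB.
  by apply: eq_bigr => j _; rewrite mulrBr.
rewrite (le_trans (ler_normD _ _))// !mulrDl lerD//.
  apply: ler_wpDl; first by rewrite mul1r.
  rewrite mulr_suml (le_trans (ler_norm_sum _ _ _))// ler_sum// => i _.
  rewrite normrM ger0_norm ?sqr_entry_ge0// -mulrA ler_wpM2l ?sqr_entry_ge0//.
  have := norm_cosB_le (x i ord0) (y i ord0); have := xy i.
  have := cos_max (y i ord0); have := cos_max (x i ord0).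
  move: (cos (x i ord0)) (cos (y i ord0)) => a b a1 b1 h1 h2.
  have -> : (1 - a) ^+ 2 - (1 - b) ^+ 2 = (2 - a - b) * (b - a) by ring.
  rewrite normrM ler_pM// 1?distrC ?(le_trans h2)//.
  by move: a1 b1; rewrite !ler_norml; lra.
rewrite mulr_suml (le_trans (ler_norm_sum _ _ _))// ler_sum// => i _.
rewrite mulr_suml (le_trans (ler_norm_sum _ _ _))// ler_sum// => j _.
rewrite normrM -mulrA ler_wpM2l//.
have := norm_sinB_le (x i ord0) (y i ord0); have := norm_sinB_le (x j ord0) (y j ord0).
have := xy i; have := xy j.
move: (sin (x i ord0)) (sin (y i ord0)) (sin_max (y i ord0)) => a a' a1.
move: (sin (x j ord0)) (sin (y j ord0)) (sin_max (x j ord0)) => b b' b1 h1 h2 h3 h4.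
have -> : a * b - a' * b' = (a - a') * b + a' * (b - b') by ring.
rewrite (le_trans (ler_normD _ _))// !normrM mulrDl mul1r lerD//.
  by rewrite -[leRHS]mulr1 ler_pM// (le_trans h4).
by rewrite -[leRHS]mul1r ler_pM// (le_trans h3).
Qed.

Lemma Gpoly_continuous : continuous (Gpoly Q).
Proof.
have [L L0 GL] := Gpoly_lipschitz.
exact: (lipschitz_continuous L0).
Qed.

End quadratic_form.

(** * The contraction B *)

Section dilation.
Variables (R : realType) (d : nat) (A : 'M[int]_d).
Hypotheses (d_gt0 : (0 < d)%N) (A_isotropic : isotropic_dilation R A).

(** [|det A|] is the modulus of the product of the [d > 0] eigenvalues, all of
    them of modulus greater than one. *)
Lemma qdet_gt1 : (1 < qdet A)%N.
Proof.
have [eig_gt1 _ _] := A_isotropic.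
set AC := map_mx intr A in eig_gt1.
have [rs /= charE] := closed_field_poly_normal (char_poly AC).
move: charE; rewrite (monicP (char_poly_monic AC)) scale1r => charE.
have rs_gt1 z : z \in rs -> 1 < `|z|.
  move=> zrs; apply: eig_gt1; rewrite eigenvalue_root_char charE.
  by rewrite root_prod_XsubC.
have rs0 : (0 < size rs)%N.
  by have := size_char_poly AC; rewrite charE size_prod_XsubC => -[->].
have : 1 < `|\det AC|.
  have -> : `|\det AC| = `|(char_poly AC)`_0|.
    by rewrite char_poly_det normrM normrX normrN1 expr1n mul1r.
  rewrite -horner_coef0 charE horner_prod normr_prod.
  under eq_bigr do rewrite hornerXsubC sub0r normrN.
  case: rs rs_gt1 rs0 {charE} => // z rs rs_gt1 _; rewrite big_cons.
  apply: (lt_le_trans (rs_gt1 z (mem_head _ _))); rewrite ler_peMr//.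
  rewrite big_seq; elim/big_rec: _ => // w y wrs y1.
  by rewrite mulr_ege1// ltW// rs_gt1// in_cons wrs orbT.
by rewrite /AC det_map_mx -intr_norm -abszE -pmulrn ltr1n.
Qed.

Local Notation AT := ((map_mx intr A : 'M[R]_d)^T).
Local Notation B := (invtr R A).

Lemma AT_unitmx : AT \in unitmx.
Proof.
rewrite unitmx_tr unitmxE unitfE det_map_mx intr_eq0 -absz_gt0.
exact: ltnW qdet_gt1.
Qed.

Lemma ATK (x : 'cV[R]_d) : B *m (AT *m x) = x.
Proof. by rewrite mulKmx ?AT_unitmx. Qed.

Lemma invtrK (x : 'cV[R]_d) : AT *m (B *m x) = x.
Proof. by rewrite mulKVmx ?AT_unitmx. Qed.

Lemma invtr_eq0 (x : 'cV[R]_d) : (B *m x == 0) = (x == 0).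
Proof.
apply/eqP/eqP => [Bx0|->]; last by rewrite mulmx0.
by rewrite -(invtrK x) Bx0 mulmx0.
Qed.

Lemma AT_intmx (k : 'cV[int]_d) : AT *m map_mx intr k = map_mx intr (A^T *m k).
Proof. by rewrite map_trmx -map_mxM. Qed.

Lemma lattice2pi_AT (x : 'cV[R]_d) : lattice2pi x -> lattice2pi (AT *m x).
Proof. by move=> [k ->]; exists (A^T *m k); rewrite -scalemxAr AT_intmx. Qed.

Lemma lattice2pi_invtr (x : 'cV[R]_d) : lattice2pi (B *m x) -> lattice2pi x.
Proof. by move/lattice2pi_AT; rewrite invtrK. Qed.

Lemma iter_invtrS n (x : 'cV[R]_d) : B ^+ n.+1 *m x = B ^+ n *m (B *m x).
Proof. by rewrite exprSr -mulmxE mulmxA. Qed.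

Lemma iter_invtrS' n (x : 'cV[R]_d) : B ^+ n.+1 *m x = B *m (B ^+ n *m x).
Proof. by rewrite exprS -mulmxE mulmxA. Qed.

Variable Q : 'M[R]_d.
Hypothesis Q_factor : isotropic_factor A Q.

Let Qpos : posdefmx Q := Q_factor.1.
Let q : R := (qdet A)%:R.
Let rho : R := q `^ (- d%:R^-1).

Let q_gt0 : 0 < q.
Proof. by rewrite ltr0n ltnW// qdet_gt1. Qed.

Lemma contraction_itv : 0 < rho < 1.
Proof.
rewrite powR_gt0//= /rho powRN invf_lt1 ?powR_gt0//.
have : 1 `^ (d%:R^-1) < q `^ (d%:R^-1).
  by rewrite gt0_ltr_powR ?nnegrE ?invr_gt0 ?ltr0n ?ler0n// ltr1n qdet_gt1.
by rewrite powR1.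
Qed.

Lemma contractionV2 : q `^ (2 / d%:R) = rho ^- 2.
Proof.
rewrite -powR_mulrn ?powR_ge0// -powRrM -powRN; congr (_ `^ _).
by rewrite mulNr opprK mulrC.
Qed.

(** [Q B = rho U Q] with [U] orthogonal, and [P x] is the squared 2-norm of
    [Q x]. *)
Lemma Pform_invtr (x : 'cV[R]_d) : Pform Q (B *m x) = rho ^+ 2 * Pform Q x.
Proof.
have [_ [U UU BE]] := Q_factor.
have QB : Q *m B = rho *: (U *m Q).
  by rewrite BE -scalemxAr !mulmxA mulmxV ?posdef_unitmx// mul1mx.
have PE y : Pform Q y = ((Q *m y)^T *m (Q *m y)) ord0 ord0.
  by rewrite /Pform trmx_mul Qpos.1 !mulmxA.
have QBx : Q *m (B *m x) = rho *: (U *m (Q *m x)).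
  by rewrite mulmxA QB -scalemxAl mulmxA.
rewrite !PE QBx -scalemxAr linearZ/= -scalemxAl scalerA mxE -expr2; congr (_ * _).
by rewrite trmx_mul -mulmxA [U^T *m _]mulmxA (mulmx1C UU) mul1mx.
Qed.

Lemma Pform_iter_invtr n (x : 'cV[R]_d) :
  Pform Q (B ^+ n *m x) = (rho ^+ n) ^+ 2 * Pform Q x.
Proof.
elim: n => [|n IH]; first by rewrite expr0 mul1mx expr1n mul1r.
by rewrite iter_invtrS' Pform_invtr IH [rho ^+ n.+1]exprS exprMn mulrA.
Qed.

(** The max-norm is equivalent to the square root of [P], which [B] multiplies
    by exactly [rho]. *)
Lemma norm_iter_invtr_le : exists2 K : R, 0 < K &
  forall n (x : 'cV[R]_d), `|B ^+ n *m x| <= K * rho ^+ n * `|x|.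
Proof.
have [c c0 cP] := Pform_ge Qpos; have [K K0 PK] := Pform_le Q.
have Kc : 0 < K / c by rewrite divr_gt0.
exists (Num.sqrt (K / c)) => [|n x]; first by rewrite sqrtr_gt0.
have /andP[r0 _] := contraction_itv.
have ge0 : 0 <= Num.sqrt (K / c) * rho ^+ n * `|x|.
  by rewrite !mulr_ge0 ?sqrtr_ge0 ?exprn_ge0// ltW.
rewrite -(@ler_pXn2r _ 2) ?nnegrE// !exprMn sqr_sqrtr ?(ltW Kc)//.
rewrite -(ler_pM2l c0) (le_trans (cP _))//.
rewrite Pform_iter_invtr; have := PK x.
rewrite -(ler_pM2l (exprn_gt0 2 (exprn_gt0 n r0))) => /le_trans; apply.
by rewrite le_eqVlt; apply/orP; left; apply/eqP; field; rewrite gt_eqF.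
Qed.

Lemma near_iter_invtr_lt (x : 'cV[R]_d) e : 0 < e ->
  \forall n \near \oo, `|B ^+ n *m x| < e.
Proof.
move=> e0; have [K K0 BK] := norm_iter_invtr_le.
have /andP[r0 r1] := contraction_itv.
have r1' : `|rho| < 1 by rewrite gtr0_norm.
have /cvgrPdist_lt/(_ _ e0) := cvg_geometric (K * `|x|) r1'.
apply: filterS => n; rewrite sub0r normrN => /=; apply: le_lt_trans.
by rewrite (le_trans (BK _ _))// mulrAC ler_norm.
Qed.

End dilation.

(** * Reduction modulo the integer vectors *)

Section fractional_part.
Variables (R : realType) (d : nat).
Implicit Types (v w : 'cV[R]_d) (k : 'cV[int]_d).

Definition floormx v : 'cV[int]_d := \col_i Num.floor (v i ord0).

Definition fracmx v : 'cV[R]_d := v - map_mx intr (floormx v).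

Lemma fracmx_itv v i : 0 <= fracmx v i ord0 < 1.
Proof.
rewrite !mxE; have := floor_itv (v i ord0).
by rewrite subr_ge0 ltrBlDl intrD addrC.
Qed.

Lemma unit_cube_int_eq v w k : (forall i, 0 <= v i ord0 < 1) ->
  (forall i, 0 <= w i ord0 < 1) -> v - w = map_mx intr k -> v = w.
Proof.
move=> v01 w01 vwk; apply/matrixP => i j; rewrite (ord1 j).
have := congr1 (fun M : 'cV[R]_d => M i ord0) vwk; rewrite !mxE => vwki.
have /andP[v0 v1] := v01 i; have /andP[w0 w1] := w01 i.
have k1 : (k i ord0)%:~R < (1%:~R : R) by rewrite -vwki; lra.
have k2 : ((-1)%:~R : R) < (k i ord0)%:~R by rewrite -vwki intrN; lra.
move: k1 k2 vwki; rewrite !ltr_int => k1 k2.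
have -> : k i ord0 = 0 by lia.
by move/eqP; rewrite subr_eq0 => /eqP.
Qed.

Lemma fracmxD_int v w k : (forall i, 0 <= v i ord0 < 1) ->
  v - w = map_mx intr k -> fracmx w = v.
Proof.
move=> v01 vwk; apply: (@unit_cube_int_eq _ _ (- k - floormx w)) => //.
  exact: fracmx_itv.
by rewrite map_mxB map_mxN -vwk /fracmx opprB addrAC.
Qed.

Variable Q : 'M[R]_d.
Hypothesis Qpos : posdefmx Q.

Lemma Gpoly_frac (x : 'cV[R]_d) v :
  Gpoly Q (x + (2 * pi) *: fracmx v) = Gpoly Q (x + (2 * pi) *: v).
Proof.
rewrite -[RHS](Gpoly_periodic Qpos _ (- floormx v)); congr Gpoly.
by rewrite map_mxN -addrA -scalerDr.
Qed.

(** By periodicity it suffices to bound [G] on a cube, where it is Lipschitz. *)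
Lemma Gpoly_le : exists2 K : R, 0 < K & forall x : 'cV[R]_d, Gpoly Q x <= K.
Proof.
have [L L0 GL] := Gpoly_lipschitz Qpos.
have pi2 : 0 < 2 * pi :> R by rewrite mulr_gt0 ?pi_gt0.
exists (L * (2 * pi)) => [|x]; first by rewrite mulr_gt0.
have -> : x = 0 + (2 * pi) *: ((2 * pi)^-1 *: x).
  by rewrite add0r scalerA divff ?gt_eqF// scale1r.
rewrite -Gpoly_frac add0r; set y := _ *: fracmx _.
have G0 : Gpoly Q 0 = 0.
  by apply/Gpoly_eq0 => //; exists 0; rewrite map_mx0 scaler0.
have := GL y 0; rewrite G0 !subr0 => /(le_trans (ler_norm _))/le_trans; apply.
rewrite ler_pM2l// normrZ gtr0_norm// ler_piMr ?(ltW pi2)//.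
apply: norm_le_coord => // i.
by have /andP[f0 /ltW f1] := fracmx_itv ((2 * pi)^-1 *: x) i; rewrite ger0_norm.
Qed.

End fractional_part.

(** * The digits and the mask *)

Section mask.
Variables (R : realType) (d : nat) (A : 'M[int]_d) (Q : 'M[R]_d).
Hypotheses (d_gt0 : (0 < d)%N) (A_isotropic : isotropic_dilation R A).
Hypothesis Qpos : posdefmx Q.
Implicit Types (x s : 'cV[R]_d) (k : 'cV[int]_d).

Local Notation AT := ((map_mx intr A : 'M[R]_d)^T).
Local Notation B := (invtr R A).
Local Notation m0 := (dilation_mask A Q).
Local Notation G := (Gpoly Q).

(** For [s] in the unit cube the integer vector [A^T s] has entries bounded by
    the sum [N] of the [|A i j|], and it determines [s]. *)
Lemma finite_digits : finite_set (digits R A).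
Proof.
pose N := (\sum_i \sum_j `|A i j|)%N.
(* integers between - N and N are encoded as naturals below 2 N + 1 *)
pose F (f : {ffun 'I_d -> 'I_(N.*2.+1)}) : 'cV[R]_d :=
  B *m \col_i ((f i)%:R - N%:R).
apply: (@sub_finite_set _ _ (F @` setT)); last first.
  by apply: finite_image; exact: finite_finset.
move=> s [s01 [k ATs]].
have kN i : `|k i ord0| <= N%:Z.
  have : `|(k i ord0)%:~R| <= N%:R :> R.
    have -> : (k i ord0)%:~R = (AT *m s) i ord0 by rewrite ATs mxE.
    rewrite mxE (le_trans (ler_norm_sum _ _ _))// /N exchange_big/=.
    rewrite natr_sum [leRHS](bigD1 i)//= ler_wpDr ?sumr_ge0//.
    rewrite natr_sum ler_sum// => j _; rewrite !mxE normrM.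
    have /andP[s0 s1] := s01 j; rewrite (ger0_norm s0).
    by rewrite -intr_norm -abszE -pmulrn ler_piMr// ltW.
  by rewrite -(ler_int R) intr_norm -pmulrn.
exists [ffun i => inord (absz (k i ord0 + N%:Z)%R)] => //.
rewrite /F -[RHS](ATK d_gt0 A_isotropic) ATs; congr (_ *m _).
apply/matrixP => i j; rewrite !mxE ffunE (ord1 j) inordK; last first.
  by have := kN i; lia.
rewrite pmulrn abszE ger0_norm; last by have := kN i; lia.
by rewrite intrD -pmulrn addrK.
Qed.

Lemma digits0 : digits R A 0.
Proof.
split=> [i|]; first by rewrite mxE lexx ltr01.
by exists 0; rewrite mulmx0 map_mx0.
Qed.

(** Translation by [A^{-T} k] permutes the classes of [S(A^T)] modulo [Z^d]. *)
Lemma digits_shift_bij k : set_bij (digits R A) (digits R A)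
  (fun s => fracmx (B *m map_mx intr k + s)).
Proof.
have shiftP l s : digits R A s -> digits R A (fracmx (B *m map_mx intr l + s)).
  move=> [s01 [j ATs]]; split; first exact: fracmx_itv.
  exists (l + j - A^T *m floormx (B *m map_mx intr l + s)).
  by rewrite mulmxBr mulmxDr invtrK// ATs AT_intmx map_mxB map_mxD.
split=> [s /shiftP//|s t|t St].
- rewrite !inE => -[s01 _] [t01 _] /= st.
  apply: (unit_cube_int_eq s01 t01 (k := floormx (B *m map_mx intr k + s) -
    floormx (B *m map_mx intr k + t))).
  rewrite map_mxB; apply/eqP; rewrite -subr_eq0; apply/eqP.
  transitivity (fracmx (B *m map_mx intr k + s) - fracmx (B *m map_mx intr k + t)).
    by apply/matrixP => i j; rewrite !mxE; ring.
  by rewrite st subrr.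
exists (fracmx (B *m map_mx intr (- k) + t)); first exact: shiftP.
case: St => t01 _ /=.
apply: (fracmxD_int (k := floormx (B *m map_mx intr (- k) + t)) t01).
by rewrite map_mxN mulmxN; apply/matrixP => i j; rewrite !mxE; ring.
Qed.

Definition digits_prod x : R :=
  \big[*%R/1]_(s \in digits R A) G (x + (2 * pi) *: s).

Lemma digits_prod_periodic x k :
  digits_prod (B *m (x + (2 * pi) *: map_mx intr k)) = digits_prod (B *m x).
Proof.
rewrite /digits_prod [RHS](reindex_fsbig _ _ _ _ (digits_shift_bij k)).
apply: eq_fsbigr => s _ /=.
by rewrite [RHS](Gpoly_frac Qpos) mulmxDr -scalemxAr -addrA -scalerDr.
Qed.

Lemma digits_prodE x :
  digits_prod x = G x * \big[*%R/1]_(s \in digits R A `\ 0) G (x + (2 * pi) *: s).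
Proof.
rewrite /digits_prod (fsbigD1 0)/= ?scaler0 ?addr0//; last exact: digits0.
exact: finite_digits.
Qed.

(** Some translate [B x + 2 pi s] is a period of [G] exactly when [x] is one. *)
Lemma digits_prod_eq0 x : digits_prod (B *m x) = 0 <-> lattice2pi x.
Proof.
split=> [|[k ->]]; last first.
  rewrite -[_ *: _]add0r digits_prod_periodic digits_prodE mulmx0.
  suff -> : G 0 = 0 by rewrite mul0r.
  by apply/(Gpoly_eq0 Qpos); exists 0; rewrite map_mx0 scaler0.
rewrite /digits_prod fsbig_finite; last exact: finite_digits.
move/eqP; rewrite prodf_seq_eq0 => /hasP[s].
rewrite in_fset_set ?inE; last exact: finite_digits.
move=> -[s01 [j ATs]] /eqP/(Gpoly_eq0 Qpos)[k] /eqP.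
rewrite -subr_eq0 -addrA -scalerBr => /eqP xE.
exists (A^T *m k - j).
apply/eqP; rewrite -subr_eq0 -(invtr_eq0 d_gt0 A_isotropic); apply/eqP.
rewrite mulmxBr -[RHS]xE -scalemxAr -scalerN; congr (_ + _ *: _).
by rewrite map_mxB -AT_intmx -ATs mulmxBr !ATK// opprB.
Qed.

Lemma digits_prod_gt0 x : ~ lattice2pi x -> 0 < digits_prod (B *m x).
Proof.
move=> xL; rewrite lt_neqAle eq_sym; apply/andP; split.
  by apply/eqP => /digits_prod_eq0.
rewrite /digits_prod fsbig_finite; last exact: finite_digits.
by rewrite prodr_ge0// => s _; exact: Gpoly_ge0.
Qed.

Lemma digit_nlattice s : digits R A s -> s != 0 -> ~ lattice2pi ((2 * pi) *: s).
Proof.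
move=> [s01 _] /eqP s0 [k /eqP]; rewrite -subr_eq0 -scalerBr scaler_eq0.
rewrite mulf_eq0 pnatr_eq0 (gt_eqF (pi_gt0 R))/= => /eqP sk; apply: s0.
apply: (unit_cube_int_eq s01 _ (k := k)) => [i|]; first by rewrite mxE lexx ltr01.
by rewrite subr0; apply/eqP; rewrite -subr_eq0 sk.
Qed.

(** A list, so that products over it are accessible to induction. *)
Definition mask_digits : seq 'cV[R]_d :=
  finmap.enum_fset (fset_set (digits R A `\ 0)).

Lemma mem_mask_digits s :
  (s \in mask_digits) = (s \in digits R A `\ 0).
Proof.
by apply: in_fset_set; apply: finite_setD; exact: finite_digits.
Qed.

Lemma Gpoly_digit_gt0 s : s \in mask_digits -> 0 < G ((2 * pi) *: s).
Proof.
rewrite mem_mask_digits inE => -[Ss s0]; apply: Gpoly_gt0 => //.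
by apply: digit_nlattice => //; apply/eqP.
Qed.

Lemma maskE x : m0 x =
  \prod_(s <- mask_digits) (G (x + (2 * pi) *: s) / G ((2 * pi) *: s)).
Proof.
by rewrite /dilation_mask fsbig_finite//; apply: finite_setD; exact: finite_digits.
Qed.

Lemma mask0 : m0 0 = 1.
Proof.
rewrite maskE big_seq big1// => s sS.
by rewrite add0r divff// gt_eqF// Gpoly_digit_gt0.
Qed.

(** The missing digit [s = 0] supplies the factor [G], so that [m0 G] is, up to
    a constant, the full product over [S(A^T)]. *)
Lemma maskMG : exists2 c : R, 0 < c & forall x, m0 x * G x = c * digits_prod x.
Proof.
exists (\prod_(s <- mask_digits) G ((2 * pi) *: s))^-1.
  by rewrite invr_gt0 big_seq prodr_gt0// => s; exact: Gpoly_digit_gt0.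
move=> x; rewrite maskE prodf_div digits_prodE fsbig_finite.
  by rewrite -/mask_digits; ring.
by apply: finite_setD; exact: finite_digits.
Qed.

Lemma mask_continuous : continuous m0.
Proof.
rewrite (_ : m0 = fun x => \prod_(s <- mask_digits)
    (G (x + (2 * pi) *: s) / G ((2 * pi) *: s))); last first.
  by apply/funext => x; exact: maskE.
elim: mask_digits => [|s S IH] x.
  rewrite (_ : (fun _ => _) = cst 1); first exact: cst_continuous.
  by apply/funext => y; rewrite big_nil.
rewrite (_ : (fun _ => _) = (fun y => G (y + (2 * pi) *: s) / G ((2 * pi) *: s) *
    \prod_(s <- S) (G (y + (2 * pi) *: s) / G ((2 * pi) *: s)))); last first.
  by apply/funext => y; rewrite big_cons.
have tr : continuous (fun y : 'cV[R]_d => y + (2 * pi) *: s).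
  by apply: (lipschitz_continuous ltr01) => y z; rewrite mul1r opprD addrACA subrr addr0.
have cG : {for x, continuous (fun y : 'cV[R]_d => G (y + (2 * pi) *: s))}.
  exact: (continuous_comp (tr x) (@Gpoly_continuous _ _ _ Qpos _)).
exact: (continuousM (continuousM cG (@cst_continuous _ _ _ x)) (IH x)).
Qed.

(** Bounded factors that are [1 + O(|x|)] uniformly in [x] have a product of the
    same kind. *)
Lemma mask_lipschitz1 :
  exists2 C : R, 0 < C & forall x, `|m0 x - 1| <= C * `|x|.
Proof.
have [L L0 GL] := Gpoly_lipschitz Qpos; have [K K0 GK] := Gpoly_le Qpos.
suff [C [D [C0 _ CD]]] : exists C D : R, [/\ 0 < C, 0 < D & forall x,
    `|m0 x - 1| <= C * `|x| /\ `|m0 x| <= D].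
  by exists C => // x; case: (CD x).
pose f S x : R := \prod_(s <- S) (G (x + (2 * pi) *: s) / G ((2 * pi) *: s)).
suff : forall S, {subset S <= mask_digits} ->
    exists C D : R, [/\ 0 < C, 0 < D & forall x,
    `|f S x - 1| <= C * `|x| /\ `|f S x| <= D].
  move=> /(_ mask_digits (fun _ => id))[C [D [C0 D0 CD]]]; exists C, D; split=> // x.
  by rewrite maskE; exact: CD.
elim=> [_|s S IH sub].
  exists 1, 1; split=> // x; rewrite /f big_nil subrr normr0 mul1r normr1.
  by split.
have [|C [D [C0 D0 CD]]] := IH.
  by move=> t tS; apply: sub; rewrite in_cons tS orbT.
have g0 : 0 < G ((2 * pi) *: s) by apply: Gpoly_digit_gt0; apply: sub; exact: mem_head.
set g := G ((2 * pi) *: s) in g0.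
exists (K / g * C + L / g), (K / g * D); split=> [||x].
- by rewrite addr_gt0 ?divr_gt0// mulr_gt0// divr_gt0.
- by rewrite mulr_gt0// divr_gt0.
have [fC fD] := CD x; rewrite /f big_cons -/(f S x) -/g.
have Gg : `|G (x + (2 * pi) *: s) / g| <= K / g.
  by rewrite normf_div ger0_norm ?Gpoly_ge0// gtr0_norm// ler_pM2r ?invr_gt0.
split; last by rewrite normrM ler_pM.
have -> : G (x + (2 * pi) *: s) / g * f S x - 1 =
    G (x + (2 * pi) *: s) / g * (f S x - 1) + (G (x + (2 * pi) *: s) - g) / g.
  by field; rewrite gt_eqF.
rewrite (le_trans (ler_normD _ _))// [leRHS]mulrDl lerD//.
  by rewrite normrM -mulrA ler_pM.
rewrite normf_div (gtr0_norm g0) mulrAC ler_pM2r ?invr_gt0//.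
by have := GL (x + (2 * pi) *: s) ((2 * pi) *: s); rewrite addrK.
Qed.

End mask.

(** * The factor mu *)

Section mu_factor.
Variables (R : realType) (d : nat) (A : 'M[int]_d) (Q : 'M[R]_d).
Hypotheses (d_gt0 : (0 < d)%N) (A_isotropic : isotropic_dilation R A).
Hypothesis Q_factor : isotropic_factor A Q.
Implicit Types (x y : 'cV[R]_d) (k : 'cV[int]_d).

Let Qpos : posdefmx Q := Q_factor.1.

Local Notation AT := ((map_mx intr A : 'M[R]_d)^T).
Local Notation B := (invtr R A).
Local Notation m0 := (dilation_mask A Q).
Local Notation G := (Gpoly Q).
Local Notation P := (Pform Q).
Local Notation H := (GP_quot 1 Q).
Local Notation M := (Mfun A Q).
Local Notation rho := ((qdet A)%:R `^ (- d%:R^-1) : R).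

Lemma lattice2pi0 : lattice2pi (0 : 'cV[R]_d).
Proof. by exists 0; rewrite map_mx0 scaler0. Qed.

Lemma GP_quot0 : H 0 = 1.
Proof. by rewrite /GP_quot eqxx. Qed.

Lemma GP_quotX m x : GP_quot m Q x = H x ^+ m.
Proof.
by rewrite /GP_quot; case: ifP => _; rewrite ?expr1n// !expr1 expr_div_n.
Qed.

Lemma GP_quotMP x : x != 0 -> H x * P x = G x.
Proof.
move=> x0; rewrite /GP_quot (negPf x0) !expr1 divfK//.
by rewrite (Pform_eq0 Qpos).
Qed.

(** [|G - P|] is of order four whereas [P] is bounded below by a multiple of
    [|x|^2]. *)
Lemma GP_quot_continuous0 : {for 0, continuous H}.
Proof.
have [c c0 cP] := Pform_ge Qpos; have [K K0 GP] := GpolyB_Pform_le Qpos.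
have HB x : `|H x - 1| <= K / c * `|x| ^+ 2.
  have [->|x0] := eqVneq x 0; first by rewrite GP_quot0 subrr !normr0 expr0n mulr0.
  have nx : 0 < `|x| by rewrite normr_gt0.
  have Px : 0 < P x by rewrite (lt_le_trans _ (cP x))// mulr_gt0// exprn_gt0.
  rewrite -(ler_pM2r Px) -{1}(gtr0_norm Px) -normrM mulrBl mul1r GP_quotMP//.
  rewrite (le_trans (GP x))//.
  have -> : K * `|x| ^+ 4 = K / c * `|x| ^+ 2 * (c * `|x| ^+ 2).
    by field; rewrite gt_eqF.
  by rewrite ler_wpM2l// !mulr_ge0 ?exprn_ge0// ?invr_ge0 ltW.
apply/continuous_dist_le => e e0; rewrite GP_quot0.
have e1 : 0 < Num.min 1 (e * c / K).
  by rewrite lt_min ltr01 divr_gt0// mulr_gt0.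
apply: filterS (near_norm (0 : 'cV[R]_d) e1) => x; rewrite sub0r normrN lt_min.
move=> /andP[x1 xe]; rewrite distrC (le_trans (HB x))//.
rewrite mulrC -ler_pdivlMr ?divr_gt0// invf_div mulrA.
rewrite expr2 (le_trans (ler_piMr _ (ltW x1)))// (le_trans (ltW xe))//.
Qed.

(** [H] would vanish at a nonzero lattice point, but it is close to [1] near the
    origin. *)
Lemma near0_nlattice : \forall x \near (0 : 'cV[R]_d), x != 0 -> ~ lattice2pi x.
Proof.
have half0 : 0 < 2^-1 :> R by rewrite invr_gt0.
have := (continuous_dist_le _ _).1 GP_quot_continuous0 _ half0.
apply: filterS => x; rewrite GP_quot0 => Hx x0 /(Gpoly_eq0 Qpos) Gx0.
move: Hx; rewrite /GP_quot (negPf x0) !expr1 Gx0 mul0r subr0 normr1; lra.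
Qed.

(** [P] satisfies [P (B x) = rho^2 P x], so replacing [G] by [H P] removes the
    factor [q^(2/d) = rho^(-2)]. *)
Lemma mu_quotE x : x != 0 -> ~ lattice2pi x ->
  mu_quot A Q x = m0 (B *m x) * H (B *m x) / H x.
Proof.
move=> x0 xL; rewrite /mu_quot contractionV2//.
have Bx0 : B *m x != 0 by rewrite (invtr_eq0 d_gt0 A_isotropic).
rewrite -GP_quotMP// -(GP_quotMP x0) Pform_invtr//.
have P0 : P x != 0 by rewrite (Pform_eq0 Qpos).
have r0 : rho != 0.
  by have /andP[r0 _] := contraction_itv d_gt0 A_isotropic; rewrite gt_eqF.
have H0 : H x != 0.
  have := Gpoly_gt0 Qpos xL; rewrite -GP_quotMP// => /lt0r_neq0.
  by rewrite mulf_eq0 negb_or => /andP[].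
by field; rewrite P0 r0 H0.
Qed.

Lemma mu_quot_digits : exists2 c : R, 0 < c &
  forall x, mu_quot A Q x = c * digits_prod A Q (B *m x) / G x.
Proof.
have [c c0 mG] := maskMG d_gt0 A_isotropic Qpos.
exists ((qdet A)%:R `^ (2 / d%:R) * c) => [|x].
  by rewrite mulr_gt0// powR_gt0// ltr0n ltnW// (qdet_gt1 d_gt0 A_isotropic).
by rewrite /mu_quot -[_ * m0 _ * _]mulrA mG mulrA.
Qed.

Lemma mu_quot_periodic x k :
  mu_quot A Q (x + (2 * pi) *: map_mx intr k) = mu_quot A Q x.
Proof.
have [c _ E] := mu_quot_digits.
by rewrite !E digits_prod_periodic// Gpoly_periodic.
Qed.

(** The formula [mu_quotE] gives the limit at the origin, where [m0] and [H]
    are [1]; the other lattice points follow by periodicity. *)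
Lemma mu_quot_cvg xi : lattice2pi xi -> mu_quot A Q eta @[eta --> xi^'] --> (1 : R).
Proof.
move=> [k xiE].
pose F x := m0 (B *m x) * H (B *m x) / H x.
have F0 : F 0 = 1.
  by rewrite /F mulmx0 GP_quot0 (mask0 d_gt0 A_isotropic Qpos) divr1 mulr1.
have FC : {for 0, continuous F}.
  have B0 : {for 0, continuous (fun x : 'cV[R]_d => B *m x)}.
    exact: mulmx_continuous.
  have mB : {for 0, continuous (fun x => m0 (B *m x))}.
    exact: (continuous_comp B0 (@mask_continuous _ _ _ _ d_gt0 A_isotropic Qpos _)).
  have HB : {for 0, continuous (fun x => H (B *m x))}.
    by apply: (continuous_comp B0); rewrite mulmx0; exact: GP_quot_continuous0.
  have HV : {for 0, continuous (fun x => (H x)^-1)}.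
    by apply: continuousV GP_quot_continuous0; rewrite GP_quot0 oner_neq0.
  exact: (continuousM (continuousM mB HB) HV).
apply/cvg_dnbhs_dist_le => e e0.
have /near_normP[r1 r10 nL] := near0_nlattice.
have /near_normP[r2 r20 FP] := (continuous_dist_le _ _).1 FC _ e0.
have r0 : 0 < Num.min r1 r2 by rewrite lt_min r10.
apply: filterS (near_norm xi r0) => eta; rewrite lt_min => /andP[eta1 eta2] neq.
have := FP (eta - xi); rewrite sub0r opprB => /(_ eta2); rewrite F0.
have := nL (eta - xi); rewrite sub0r opprB subr_eq0 => /(_ eta1 neq) nLx.
by rewrite /F -mu_quotE ?subr_eq0// -(mu_quot_periodic _ k) -xiE subrK.
Qed.

Lemma punctured_nbhs_proper (xi : 'cV[R]_d) : ProperFilter xi^'.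
Proof.
apply: (@dnbhs_proper _ _ (const_mx 1)); apply/eqP.
move=> /matrixP/(_ (Ordinal d_gt0) ord0)/eqP.
by rewrite !mxE oner_eq0.
Qed.

Lemma mu_lattice x : lattice2pi x -> mu A Q x = 1.
Proof.
move=> xL; rewrite /mu; case: asboolP => // _.
by apply: cvg_lim => //; [exact: punctured_nbhs_proper|exact: mu_quot_cvg].
Qed.

Lemma mu_nlattice x : ~ lattice2pi x -> mu A Q x = mu_quot A Q x.
Proof. by move=> xL; rewrite /mu; case: asboolP. Qed.

Lemma mu_gt0 x : 0 < mu A Q x.
Proof.
have [xL|xL] := pselect (lattice2pi x); first by rewrite mu_lattice.
have [c c0 E] := mu_quot_digits.
rewrite mu_nlattice// E divr_gt0 ?(Gpoly_gt0 Qpos)//.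
by rewrite mulr_gt0// digits_prod_gt0.
Qed.

(** Off the lattice [G] does not vanish, and the lattice is closed as the set of
    zeros of [G]; so [mu] agrees with the quotient in a neighbourhood. *)
Lemma mu_continuous : continuous (mu A Q).
Proof.
move=> x; have [xL|xL] := pselect (lattice2pi x).
  apply/continuous_dist_le => e e0; rewrite mu_lattice//.
  have := (cvg_dnbhs_dist_le _ _ _).1 (mu_quot_cvg xL) _ e0.
  apply: filterS => y /= yP.
  have [yL|yL] := pselect (lattice2pi y).
    by rewrite mu_lattice// subrr normr0 ltW.
  rewrite mu_nlattice//; apply: yP.
  by apply/eqP => yx; apply: yL; rewrite yx.
have Gx0 := Gpoly_gt0 Qpos xL.
have GB : {for x, continuous (fun y => G (B *m y))}.
  exact: (continuous_comp (@mulmx_continuous _ _ _ x) (@Gpoly_continuous _ _ _ Qpos _)).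
have mB : {for x, continuous (fun y => m0 (B *m y))}.
  exact: (continuous_comp (@mulmx_continuous _ _ _ x)
    (@mask_continuous _ _ _ _ d_gt0 A_isotropic Qpos _)).
have GV : {for x, continuous (fun y => (G y)^-1)}.
  by apply: continuousV (@Gpoly_continuous _ _ _ Qpos x); rewrite gt_eqF.
have muC : {for x, continuous (mu_quot A Q)}.
  exact: (continuousM (continuousM (continuousM (@cst_continuous _ _ _ x) mB) GB) GV).
apply/continuous_dist_le => e e0; rewrite mu_nlattice//.
have G2 : 0 < G x / 2 by rewrite divr_gt0.
have Gnear := (continuous_dist_le _ _).1 (@Gpoly_continuous _ _ _ Qpos x) _ G2.
apply: filterS2 Gnear ((continuous_dist_le _ _).1 muC _ e0) => y Gy.
rewrite mu_nlattice// => /(Gpoly_eq0 Qpos) Gy0.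
by move: Gy; rewrite Gy0 subr0 gtr0_norm//; lra.
Qed.

End mu_factor.

(** * The infinite products *)

Section scaling_product.
Variables (R : realType) (d : nat) (A : 'M[int]_d) (Q : 'M[R]_d).
Hypotheses (d_gt0 : (0 < d)%N) (A_isotropic : isotropic_dilation R A).
Hypothesis Q_factor : isotropic_factor A Q.
Implicit Types (x y : 'cV[R]_d) (k : 'cV[int]_d).

Let Qpos : posdefmx Q := Q_factor.1.

Local Notation AT := ((map_mx intr A : 'M[R]_d)^T).
Local Notation B := (invtr R A).
Local Notation m0 := (dilation_mask A Q).
Local Notation G := (Gpoly Q).
Local Notation P := (Pform Q).
Local Notation H := (GP_quot 1 Q).
Local Notation Mpart := (M_partial A Q).
Local Notation M := (Mfun A Q).
Local Notation rho := ((qdet A)%:R `^ (- d%:R^-1) : R).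

(** The partial products of the dilated masks for [m = 1], indexed from zero so
    as to match those of [M]. *)
Definition dilates_prod x n : R := \prod_(0 <= j < n) m0 (B ^+ j.+1 *m x).

Definition dilates_lim x : R := lim (dilates_prod x n @[n --> \oo]).

(** [|m0 y - 1| <= C |y|] and [B^j x] is geometrically small, with a bound
    proportional to [|x|]; hence the products are close to [1] for small [x]. *)
Lemma dilates_prod_bound : exists2 D : R, 0 < D & forall x,
  cvg (dilates_prod x n @[n --> \oo]) /\
  forall n, `|dilates_prod x n - 1| <= expR (D * `|x|) * (D * `|x|).
Proof.
have [C C0 mC] := mask_lipschitz1 d_gt0 A_isotropic Qpos.
have [K K0 BK] := norm_iter_invtr_le d_gt0 A_isotropic Q_factor.
have /andP[r0 r1] := contraction_itv d_gt0 A_isotropic.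
have CK0 : 0 < C * K by rewrite mulr_gt0.
exists (C * K / (1 - rho)) => [|x]; first by rewrite divr_gt0// subr_gt0.
have Cx : 0 <= C * K * `|x| by rewrite mulr_ge0// ltW.
have r01 : 0 <= rho < 1 by rewrite r1 andbT ltW.
have bnd j : `|m0 (B ^+ j.+1 *m x) - 1| <= C * K * `|x| * rho ^+ j.
  rewrite (le_trans (mC _))// -2!mulrA ler_pM2l// (le_trans (BK _ _))//.
  rewrite mulrAC -mulrA ler_pM2l// ler_wpM2l// exprS ler_piMl ?exprn_ge0//; exact: ltW.
have [cvgD bD] := cvg_prod_geometric Cx r01 bnd; split=> // n.
apply: le_trans (bD n) _; rewrite le_eqVlt; apply/orP; left; apply/eqP.
by rewrite [in RHS]mulrAC !mulrA.
Qed.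

Lemma dilates_prod_cvg x : dilates_prod x n @[n --> \oo] --> dilates_lim x.
Proof. by have [D _ /(_ x)[]] := dilates_prod_bound. Qed.

Lemma dilates_lim0 : dilates_lim 0 = 1.
Proof.
apply: cvg_lim => //; rewrite (_ : dilates_prod 0 = cst 1); first exact: cvg_cst.
apply/funext => n; rewrite /dilates_prod big1// => j _.
by rewrite mulmx0 (mask0 d_gt0 A_isotropic Qpos).
Qed.

Lemma dilates_lim_continuous0 : {for 0, continuous dilates_lim}.
Proof.
have [D D0 DP] := dilates_prod_bound.
apply/continuous_dist_le => e e0; rewrite dilates_lim0.
have r0 : 0 < Num.min D^-1 (e / (D * expR 1)).
  by rewrite lt_min invr_gt0 D0 divr_gt0// mulr_gt0// expR_gt0.
apply: filterS (near_norm (0 : 'cV[R]_d) r0) => x.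
rewrite sub0r normrN lt_min => /andP[x1 x2].
have [cx bx] := DP x.
have cabs : `|1 - dilates_prod x n| @[n --> \oo] --> `|1 - dilates_lim x|.
  by apply: cvg_norm; apply: cvgB; [exact: cvg_cst|exact: dilates_prod_cvg].
rewrite -(cvg_lim _ cabs)//; apply: limr_le; first by apply/cvg_ex; eexists; exact: cabs.
(* for D |x| <= 1 the exponential is at most expR 1 *)
near=> n; rewrite distrC (le_trans (bx n))//.
have Dx1 : D * `|x| <= 1 by rewrite -ler_pdivlMl// mulr1 ltW.
rewrite (@le_trans _ _ (expR 1 * (D * `|x|)))//.
  by rewrite ler_wpM2r ?ler_expR// mulr_ge0// ltW.
by rewrite mulrA mulrC -ler_pdivlMr ?mulr_gt0 ?expR_gt0// [expR 1 * D]mulrC ltW.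
Unshelve. all: by end_near. Qed.

Lemma nlattice_iter_invtr x n : ~ lattice2pi x -> ~ lattice2pi (B ^+ n *m x).
Proof.
elim: n => [|n IH] xL; first by rewrite expr0 mul1mx.
by rewrite iter_invtrS' => /(lattice2pi_invtr d_gt0 A_isotropic); exact: IH.
Qed.

Lemma near_iter_invtr_nlattice x : x != 0 ->
  \forall n \near \oo, ~ lattice2pi (B ^+ n *m x).
Proof.
move=> x0; have /near_normP[r r0 rL] := near0_nlattice Q_factor.
apply: filterS (near_iter_invtr_lt d_gt0 A_isotropic Q_factor x r0) => n nr.
apply: rL; first by rewrite sub0r normrN.
elim: n {nr} => [|n IH]; first by rewrite expr0 mul1mx.
by rewrite iter_invtrS' (invtr_eq0 d_gt0 A_isotropic).
Qed.

Lemma GP_quot_neq0 x : x = 0 \/ ~ lattice2pi x -> H x != 0.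
Proof.
have [->|x0] := eqVneq x 0; first by rewrite GP_quot0 oner_neq0.
move=> [/eqP|xL]; first by rewrite (negPf x0).
have := Gpoly_gt0 Qpos xL; rewrite -(GP_quotMP Q_factor x0) => /lt0r_neq0.
by rewrite mulf_eq0 negb_or => /andP[].
Qed.

(** [mu x = m0 (B x) (G/P)(B x) / (G/P)(x)] telescopes along the orbit. *)
Lemma M_partial_telescope x n : x = 0 \/ ~ lattice2pi x ->
  Mpart x n * H x = dilates_prod x n * H (B ^+ n *m x).
Proof.
move=> xadm; elim: n => [|n IH].
  by rewrite /M_partial /dilates_prod !big_geq// expr0 mul1mx.
rewrite /M_partial /dilates_prod !big_nat_recr//= -/(Mpart x n) -/(dilates_prod x n).
rewrite mulrAC IH -!mulrA; congr (_ * _); rewrite iter_invtrS'.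
have : B ^+ n *m x = 0 \/ ~ lattice2pi (B ^+ n *m x).
  case: xadm => [->|xL]; [by left; rewrite mulmx0|right].
  exact: nlattice_iter_invtr.
move: (B ^+ n *m x) => y yadm; have [y0|y0] := eqVneq y 0.
  rewrite y0 mulmx0 GP_quot0 (mask0 d_gt0 A_isotropic Qpos).
  by rewrite (mu_lattice d_gt0 A_isotropic Q_factor)//; exact: lattice2pi0.
have yL : ~ lattice2pi y by case: yadm => // /eqP; rewrite (negPf y0).
rewrite mu_nlattice// (mu_quotE d_gt0 A_isotropic Q_factor)//.
by rewrite mulrC divfK// GP_quot_neq0.
Qed.

Lemma M_partialD x n p : Mpart x (n + p) = Mpart x n * Mpart (B ^+ n *m x) p.
Proof.
rewrite /M_partial (@big_cat_nat _ _ _ n)//= ?leq_addr//; congr (_ * _).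
rewrite -{1}[n]add0n big_addn addKn; apply: eq_bigr => j _.
by rewrite exprD mulmxA mulmxE.
Qed.


Lemma GP_quot_iter_cvg x : H (B ^+ n *m x) @[n --> \oo] --> (1 : R).
Proof.
apply/cvgrPdist_le => e e0.
have /near_normP[r r0 rH] :=
  (continuous_dist_le _ _).1 (GP_quot_continuous0 Q_factor) _ e0.
apply: filterS (near_iter_invtr_lt d_gt0 A_isotropic Q_factor x r0) => n nr.
by have := rH (B ^+ n *m x); rewrite GP_quot0 sub0r normrN; apply.
Qed.

Lemma M_partial_cvg_adm x : x = 0 \/ ~ lattice2pi x ->
  Mpart x n @[n --> \oo] --> dilates_lim x / H x.
Proof.
move=> xadm; have H0 := GP_quot_neq0 xadm.
rewrite (_ : Mpart x = fun n => dilates_prod x n * H (B ^+ n *m x) / H x); last first.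
  by apply/funext => n; rewrite -M_partial_telescope// mulfK.
apply: cvgMr_tmp; rewrite -[X in _ --> X]mulr1.
by apply: cvgM; [exact: dilates_prod_cvg|exact: GP_quot_iter_cvg].
Qed.

(** The orbit of a nonzero point eventually stays outside the lattice, where the
    telescoping formula applies. *)
Lemma M_partial_cvg x : Mpart x n @[n --> \oo] --> M x.
Proof.
suff : cvg (Mpart x n @[n --> \oo]) by [].
have [->|x0] := eqVneq x 0.
  by apply/cvg_ex; eexists; apply: M_partial_cvg_adm; left.
have [N _ NL] := near_iter_invtr_nlattice x0.
apply/cvg_ex; exists (Mpart x N * (dilates_lim (B ^+ N *m x) / H (B ^+ N *m x))).
rewrite -(cvg_shiftn N).
rewrite (_ : (fun n => _) = fun n => Mpart x N * Mpart (B ^+ N *m x) n).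
  by apply: cvgMl_tmp; apply: M_partial_cvg_adm; right; apply: NL => /=.
by apply/funext => n; rewrite addnC M_partialD.
Qed.

Lemma MfunE x n : M x = Mpart x n * M (B ^+ n *m x).
Proof.
apply: cvg_lim => //; rewrite -(cvg_shiftn n).
rewrite (_ : (fun p => _) = fun p => Mpart x n * Mpart (B ^+ n *m x) p).
  by apply: cvgMl_tmp; exact: M_partial_cvg.
by apply/funext => p; rewrite addnC M_partialD.
Qed.

Lemma Mfun_adm x : x = 0 \/ ~ lattice2pi x -> M x = dilates_lim x / H x.
Proof. by move=> xadm; apply: cvg_lim => //; exact: M_partial_cvg_adm. Qed.

Lemma Mfun0 : M 0 = 1.
Proof. by rewrite Mfun_adm; [rewrite dilates_lim0 GP_quot0 divr1|left]. Qed.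

Lemma Mfun_continuous0 : {for 0, continuous M}.
Proof.
have HV : {for 0, continuous (fun x => (H x)^-1)}.
  by apply: continuousV (GP_quot_continuous0 Q_factor); rewrite GP_quot0 oner_neq0.
have qC : {for 0, continuous (fun x => dilates_lim x / H x)}.
  exact: (continuousM dilates_lim_continuous0 HV).
apply/continuous_dist_le => e e0.
apply: filterS2 (near0_nlattice Q_factor) ((continuous_dist_le _ _).1 qC _ e0) => x.
move=> nL; rewrite dilates_lim0 GP_quot0 divr1 Mfun0 Mfun_adm//.
by have [|x0] := eqVneq x 0; [left|right; exact: nL].
Qed.

Lemma M_partial_gt0 x n : 0 < Mpart x n.
Proof. by apply: prodr_gt0 => j _; exact: mu_gt0. Qed.

Lemma near_Mfun_iter_gt0 x : \forall n \near \oo, 2^-1 <= M (B ^+ n *m x).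
Proof.
have half0 : 0 < 2^-1 :> R by rewrite invr_gt0.
have /near_normP[r r0 rM] := (continuous_dist_le _ _).1 Mfun_continuous0 _ half0.
apply: filterS (near_iter_invtr_lt d_gt0 A_isotropic Q_factor x r0) => n nr.
have := rM (B ^+ n *m x); rewrite sub0r normrN => /(_ nr).
by rewrite Mfun0 ler_norml; lra.
Qed.

Lemma Mfun_gt0 x : 0 < M x.
Proof.
have [N _ /(_ N (leqnn N))/= NM] := near_Mfun_iter_gt0 x.
by rewrite (MfunE x N) mulr_gt0 ?M_partial_gt0//; lra.
Qed.

Lemma M_partial_continuous n : continuous (Mpart^~ n).
Proof.
move=> x; elim: n => [|n IH].
  rewrite (_ : Mpart^~ 0 = cst 1); first exact: cst_continuous.
  by apply/funext => y; rewrite /M_partial big_geq.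
rewrite (_ : Mpart^~ n.+1 = fun y => Mpart y n * mu A Q (B ^+ n *m y)); last first.
  by apply/funext => y; rewrite /M_partial big_nat_recr.
have muC : {for x, continuous (fun y => mu A Q (B ^+ n *m y))}.
  exact: (continuous_comp (@mulmx_continuous _ _ (B ^+ n) x)
    (mu_continuous d_gt0 A_isotropic Q_factor (x := _))).
exact: (continuousM IH muC).
Qed.

(** [M x = Mpart x n * M (B^n x)] transports continuity at the origin to any
    point, since [B^n x] is arbitrarily close to the origin. *)
Lemma Mfun_continuous : continuous M.
Proof.
move=> x; apply/continuous_dist_le => e e0.
have Mx := Mfun_gt0 x.
(* e1 <= 1/2 keeps the tail factors between 1/2 and 3/2, so the head factor at x
   is at most 2 M x and a variation 2 e1 of the tail costs at most e/2 *)
pose e1 := Num.min (2^-1) (e / (8 * M x)).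
have e10 : 0 < e1 by rewrite lt_min invr_gt0/= ltr0n divr_gt0// mulr_gt0.
have e12 : e1 <= 2^-1 by rewrite ge_min lexx.
have e1M : e1 * (8 * M x) <= e.
  by rewrite -ler_pdivlMr ?mulr_gt0// ge_min lexx orbT.
have /near_normP[r r0 rM] := (continuous_dist_le _ _).1 Mfun_continuous0 _ e10.
have Mnear y : `|y| < r -> 1 - e1 <= M y <= 1 + e1.
  by move=> yr; have := rM y; rewrite sub0r normrN Mfun0 ler_norml => /(_ yr); lra.
have r2 : 0 < r / 2 by rewrite divr_gt0.
have [N _ /(_ N (leqnn N))/= xN] :=
  near_iter_invtr_lt d_gt0 A_isotropic Q_factor x r2.
have e4 : 0 < e / 4 by rewrite divr_gt0.
have BC := (continuous_dist_le _ _).1 (@mulmx_continuous _ _ (B ^+ N) x) _ r2.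
have MC := (continuous_dist_le _ _).1 (@M_partial_continuous N x) _ e4.
apply: filterS2 BC MC => y By My.
have yN : `|B ^+ N *m y| < r.
  rewrite -[X in `|X|](subKr (B ^+ N *m x)) (le_lt_trans (ler_normB _ _))//.
  by rewrite [ltRHS]splitr ltr_leD.
have /Mnear Mu : `|B ^+ N *m x| < r.
  by rewrite (lt_trans xN)// ltr_pdivrMr// ltr_pMr// ltr1n.
have /Mnear Mv := yN.
have aM := MfunE x N; rewrite aM (MfunE y N) in Mx e1M *.
move: (Mpart x N) (Mpart y N) (M_partial_gt0 x N) My Mx e1M => a b a0 ab.
move: (M (B ^+ N *m x)) (M (B ^+ N *m y)) Mu Mv => u v Mu Mv Mx e1M.
have -> : a * u - b * v = a * (u - v) + (a - b) * v by ring.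
rewrite (le_trans (ler_normD _ _))// !normrM (gtr0_norm a0).
have uv : `|u - v| <= 2 * e1 by rewrite ler_norml; lra.
have v2 : `|v| <= 2 by rewrite ler_norml; lra.
have h1 : a * `|u - v| <= a * (2 * e1) by rewrite ler_wpM2l// ltW.
have h2 : `|a - b| * `|v| <= e / 4 * 2 by rewrite ler_pM.
have h3 : a * (2 * e1) <= e / 2.
  have : e1 * (8 * (a * 2^-1)) <= e1 * (8 * (a * u)).
    by rewrite ler_pM2l// ler_pM2l// ler_pM2l//; lra.
  lra.
lra.
Qed.

(** The last point of the orbit in the lattice is followed by a zero of [m0]. *)
Lemma mask_eq0 x : lattice2pi x -> ~ lattice2pi (B *m x) -> m0 (B *m x) = 0.
Proof.
move=> xL BxL; have [c c0 mG] := maskMG d_gt0 A_isotropic Qpos.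
have := mG (B *m x); rewrite (digits_prod_eq0 d_gt0 A_isotropic Qpos x).2// mulr0.
by move/eqP; rewrite mulf_eq0 (gt_eqF (Gpoly_gt0 Qpos BxL)) orbF => /eqP.
Qed.

Lemma dilates_lim_lattice x : x != 0 -> lattice2pi x -> dilates_lim x = 0.
Proof.
move=> x0 xL; have [N _ /(_ N (leqnn N))/= NL] := near_iter_invtr_nlattice x0.
have [j mj] : exists j, m0 (B ^+ j.+1 *m x) = 0.
  elim: N NL => [|N IH] NL; first by move: NL; rewrite expr0 mul1mx.
  have [BL|/IH//] := pselect (lattice2pi (B ^+ N *m x)).
  exists N; rewrite iter_invtrS'; apply: mask_eq0 => //.
  by rewrite -iter_invtrS'.
apply: cvg_lim => //; apply: cvg_near_cst.
exists j.+1 => // n /= jn; apply/eqP; rewrite prodf_seq_eq0.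
by apply/hasP; exists j; rewrite ?mem_index_iota//= mj.
Qed.

Lemma dilates_limE x : dilates_lim x = H x * M x.
Proof.
have [xadm|/not_orP[/eqP x0 /contrapT xL]] := pselect (x = 0 \/ ~ lattice2pi x).
  by rewrite Mfun_adm// mulrC divfK// GP_quot_neq0.
rewrite dilates_lim_lattice//.
by rewrite /GP_quot (negPf x0) !expr1 ((Gpoly_eq0 Qpos x).2 xL) !mul0r.
Qed.

Lemma mask_partialE m x n :
  mask_partial B (fun eta => m0 eta ^+ m) x n = dilates_prod x n ^+ m.
Proof.
by rewrite /mask_partial /dilates_prod big_add1/= prodrXl.
Qed.

Lemma mask_prod_cvg m x :
  mask_partial B (fun eta => m0 eta ^+ m) x n @[n --> \oo] -->
  GP_quot m Q x * M x ^+ m.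
Proof.
rewrite GP_quotX -exprMn -dilates_limE.
rewrite (_ : mask_partial _ _ x = fun n => dilates_prod x n ^+ m); last first.
  by apply/funext => n; rewrite mask_partialE.
apply: (cvg_comp _ (fun t : R => t ^+ m)); first exact: dilates_prod_cvg.
exact: exprn_continuous.
Qed.

Lemma Mfun_AT x : lattice2pi x -> M (AT *m x) = M x.
Proof.
move=> xL; rewrite (MfunE _ 1) expr1 (ATK d_gt0 A_isotropic).
rewrite /M_partial big_nat1 expr0 mul1mx.
by rewrite (mu_lattice d_gt0 A_isotropic Q_factor) ?mul1r//; exact: lattice2pi_AT.
Qed.

(** [M] takes the same positive value along the orbit under [A^T] of a nonzero
    lattice point, and that orbit is unbounded as [B] contracts. *)
Lemma Mfun_not_to_0 m : ~ tends_to_0_at_infinity (fun x => M x ^+ m).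
Proof.
pose x0 : 'cV[R]_d := (2 * pi) *: const_mx 1.
have x0L : lattice2pi x0 by exists (const_mx 1); rewrite map_const_mx.
have x0N : 0 < `|x0|.
  rewrite normr_gt0 scaler_eq0 gt_eqF ?mulr_gt0 ?pi_gt0//=; apply/eqP.
  by move=> /matrixP/(_ (Ordinal d_gt0) ord0)/eqP; rewrite !mxE oner_eq0.
have orbitP n : exists x, [/\ lattice2pi x, B ^+ n *m x = x0 & M x = M x0].
  elim: n => [|n [x [xL Bx Mx]]]; first by exists x0; rewrite expr0 mul1mx.
  exists (AT *m x); split; first exact: lattice2pi_AT.
    by rewrite iter_invtrS (ATK d_gt0 A_isotropic).
  by rewrite Mfun_AT.
move=> /(_ (M x0 ^+ m))[|r rM]; first by rewrite exprn_gt0// Mfun_gt0.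
have [K K0 BK] := norm_iter_invtr_le d_gt0 A_isotropic Q_factor.
have /andP[rho0 rho1] := contraction_itv d_gt0 A_isotropic.
have rho1' : `|rho| < 1 by rewrite gtr0_norm.
have /cvgrPdist_lt/(_ _ x0N)[N _ /(_ N (leqnn N))/=] :=
  cvg_geometric (K * `|r|) rho1'.
rewrite sub0r normrN => Nr; have [x [xL Bx Mx]] := orbitP N.
have /rM : r < `|x|.
  rewrite ltNge; apply/negP => xr.
  have := BK N x; rewrite Bx leNgt => /negP; apply.
  apply: le_lt_trans Nr; rewrite mulrAC (le_trans _ (ler_norm _))//.
  rewrite ler_wpM2r ?exprn_ge0 ?(ltW rho0)// ler_wpM2l ?(ltW K0)//.
  exact: le_trans (ler_norm r).
by rewrite Mx gtr0_norm ?ltxx// exprn_gt0// Mfun_gt0.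
Qed.

End scaling_product.

(** * The theorem *)

Theorem mainTheorem1 (R : realType) (d : nat) (A : 'M[int]_d) (Q : 'M[R]_d)
    (m : nat) (d_gt0 : (0 < d)%N) (m_gt0 : (0 < m)%N)
    (A_isotropic : isotropic_dilation R A) (Q_factor : isotropic_factor A Q) :
  (* the limits defining mu on 2 pi Z^d and M exist *)
  (forall xi : 'cV[R]_d, lattice2pi xi ->
     cvg (mu_quot A Q eta @[eta --> xi^'])) /\
  (forall xi : 'cV[R]_d, cvg (M_partial A Q xi n @[n --> \oo])) /\
  (* the infinite product converges, to G^m / P^m M^m *)
  (forall xi : 'cV[R]_d,
     cvg (mask_partial (invtr R A) (fun eta => dilation_mask A Q eta ^+ m) xi n
            @[n --> \oo]) /\
     mask_prod (invtr R A) (fun eta => dilation_mask A Q eta ^+ m) xi =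
       GP_quot m Q xi * Mfun A Q xi ^+ m) /\
  (forall phi : ('cV[R]_d -> R[i]) -> R[i],
     scaling_function A (fun eta => dilation_mask A Q eta ^+ m) phi ->
     has_fourier_transform phi
       (fun xi => GP_quot m Q xi * Mfun A Q xi ^+ m)) /\
  continuous (fun xi : 'cV[R]_d => Mfun A Q xi ^+ m) /\
  ~ tends_to_0_at_infinity (fun xi : 'cV[R]_d => Mfun A Q xi ^+ m).
Proof.
have mask_prodE xi :
    mask_prod (invtr R A) (fun eta => dilation_mask A Q eta ^+ m) xi =
    GP_quot m Q xi * Mfun A Q xi ^+ m.
  by apply: cvg_lim => //; exact: (mask_prod_cvg d_gt0 A_isotropic Q_factor).
split=> [xi xiL|].
  by apply/cvg_ex; exists 1; exact: mu_quot_cvg.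
split=> [xi|].
  by apply/cvg_ex; eexists; exact: M_partial_cvg.
split=> [xi|].
  split; last exact: mask_prodE.
  by apply/cvg_ex; eexists; exact: (mask_prod_cvg d_gt0 A_isotropic Q_factor).
split=> [phi [_ phiF]|].
  by rewrite -(funext mask_prodE).
split; last exact: Mfun_not_to_0.
move=> xi.
exact: (continuous_comp (Mfun_continuous d_gt0 A_isotropic Q_factor (x := xi))
  (@exprn_continuous R m (Mfun A Q xi))).
Qed.
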